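(* Let $\{f(n)\}_{n\ge1}$ be a sequence of real numbers satisfying both hypotheses (Arithmetical Sequence) and (Equidistribution in arithmetic progressions) stated in the context, with data $J$, $h_j$, $u_j$, $Q$, $L$. Let $x\ge1$, $N>0$, $R>0$ be real and let $a$ be a nonzero integer with $-x/N<a\le x$ and $N+1\le\min\{Q(x),R\}$. Then $$\sum_{x/N<q\le x}\Big(\sum_{\substack{a<n\le x\\ n\equiv a\bmod q}}f(n)-\rho^*_R(x;q,a)\Big)\ll N(\log R)\,u_1^*(x,R)+\tau(|a|)\frac{U_0(x)}{L(x)},$$ where $$u_1^*(x,R)=\sum_{0\le j<J}(|u_j(x)|+1)\sum_{r\le R}\frac{|(h_j*\mu)(r)|\,r}{\phi(r)}.$$ The same bound holds for the sum over the moduli $1\le q\le N$, i.e. for $\sum_{1\le q\le N}\big(\sum_{a<n\le x,\ n\equiv a\bmod q}f(n)-\rho_R^*(x;q,a)\big)$. Moreover, for $a>0$ the condition $N+1\le\min\{Q(x),R\}$ can be relaxed to $N\le\min\{Q(x),R\}$. The implied constants depend only on the sequence and the data and implied constants in the two hypotheses.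
   Context: All sums over $n$ run over positive integers $n$; $q,r,d$ denote positive integers; $(r,n)$ is the gcd; $\phi$ is Euler's function, $\mu$ the Möbius function, $\tau$ the number-of-divisors function, $*$ Dirichlet convolution. $Q(x)$ and $L(x)$ are two real functions (think of $Q(x)$ as a small power of $x$ and $L(x)$ as a power of $\log x$). Hypothesis (Arithmetical Sequence). There exist an integer $J\ge0$, arithmetical functions $h_j$ (not necessarily multiplicative) and monotonic smooth functions $u_j:\mathbb{R}_{\ge0}\to\mathbb{R}$, $0\le j<J$ (extended by $u_j(t)=0$ for $t<0$), such that, with $U_j(x)=\int_0^xu_j(t)\,dt$, uniformly for $1\le d\le x$, $$\sum_{\substack{n\le x\\ d\mid n}}f(n)=\sum_{0\le j<J}\frac{h_j(d)}{d}U_j(x)+O\Big(\frac{U_0(x)}{L(x)(\log Q(x))^2}\Big).$$ Hypothesis (Equidistribution in arithmetic progressions). For $x\ge1$, $$\sum_{q\le Q(x)}\max_{y\le x}\max_{1\le a\le q}\Big|\sum_{\substack{n\le y\\ n\equiv a\bmod q}}f(n)-\frac1{\phi(q/(q,a))}\sum_{\substack{n\le y\\ (n,q)=(a,q)}}f(n)\Big|\ll\frac{U_0(x)}{L(x)}.$$ Under these hypotheses define $$F_R(n)=\sum_{0\le j<J}u_j(n)\sum_{r\le R}\frac{(h_j*\mu)(r)}{\phi(r/(r,n))}\,\mu\Big(\frac r{(r,n)}\Big),\qquad \rho^*_R(x;q,a)=\sum_{\substack{a<n\le x\\ n\equiv a\bmod q}}F_R(n).$$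
   Formalization: Added, as the claim fails for arbitrary Q, L: for x≥2, L(x)>0, Q(x)>1 and U_0/(L log²Q) is nondecreasing up to a constant factor in absolute value; L(x)≠0; and for a>0 the relaxed condition N≤min{Q(x),R} also requires min{Q(x),R}≥2 (the claim fails at N=R=1). *)

(* Defs.v *)
From HB Require Import structures.
From mathcomp Require Import all_boot all_order all_algebra.
From mathcomp Require Import all_classical all_reals all_analysis.
Set Implicit Arguments.
Unset Strict Implicit.
Unset Printing Implicit Defensive.
Import Order.TTheory GRing.Theory Num.Theory.
Import numFieldNormedType.Exports.
Local Open Scope classical_set_scope.
Local Open Scope ring_scope.

Definition ntau (n : nat) : nat := size (divisors n).

Definition moebius (n : nat) : int :=
  if (0 < n)%N && all (fun p => logn p n == 1%N) (primes n)
  then (-1) ^+ size (primes n) else 0.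

Definition dconv (A : pzRingType) (g k : nat -> A) (n : nat) : A :=
  \sum_(d <- divisors n) g d * k (n %/ d)%N.

Section Data.
Variable K : realType.
Implicit Types (f : nat -> K) (u : nat -> K -> K) (h : nat -> nat -> K).
Implicit Types (Q L : K -> K) (x y N R : K) (J : nat).

(* [Num.truncn y] is the floor of [y] for [0 <= y] and [0] for [y < 0], so a
   sum over [1 <= n < (Num.truncn y).+1] is a sum over the positive integers
   [n <= y], for every real [y]. *)

(* C^oo on the closed half-line: restriction of a C^oo function on the line. *)
Definition smooth_nneg (v : K -> K) : Prop :=
  exists w : K -> K,
    (forall (n : nat) (t : K), derivable (derive1n n w) t 1) /\
    (forall t : K, 0 <= t -> v t = w t).

Definition monotonic_nneg (v : K -> K) : Prop :=
  (forall s t : K, 0 <= s -> s <= t -> v s <= v t) \/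
  (forall s t : K, 0 <= s -> s <= t -> v t <= v s).

Definition Uint u (j : nat) (x : K) : K :=
  Rintegral lebesgue_measure `[0, x] (u j).

Definition as_error u Q L (x : K) : K :=
  `|Uint u 0 x / (L x * ln (Q x) ^+ 2)|.

(* The estimate is void at the points where its error term is undefined
   (division by zero, or [Q x <= 0], where the library sets [ln] to 0). *)
Definition arithmetical_sequence f J h u Q L : Prop :=
  (forall j, (j < J)%N ->
     [/\ smooth_nneg (u j), monotonic_nneg (u j)
       & forall t : K, t < 0 -> u j t = 0]) /\
  (exists C : K, forall (x : K) (d : nat),
     (1 <= d)%N -> d%:R <= x -> L x != 0 -> ln (Q x) != 0 ->
     `| \sum_(1 <= n < (Num.truncn x).+1 | (d %| n)%N) f n
        - \sum_(0 <= j < J) h j d / d%:R * Uint u j x |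
     <= C * as_error u Q L x).

Definition ap_discrepancy f (q a : nat) (y : K) : K :=
  `| \sum_(1 <= n < (Num.truncn y).+1 | n == a %[mod q]) f n
     - (totient (q %/ gcdn q a))%:R^-1 *
       \sum_(1 <= n < (Num.truncn y).+1 | gcdn n q == gcdn a q) f n |.

Definition max_ap_discrepancy f (q : nat) (x : K) : K :=
  sup [set z | exists y : K, exists a : nat,
         [/\ y <= x, (1 <= a <= q)%N & z = ap_discrepancy f q a y]].

Definition equidistribution f u Q L : Prop :=
  exists C : K, forall x : K, 1 <= x -> L x != 0 ->
    \sum_(1 <= q < (Num.truncn (Q x)).+1) max_ap_discrepancy f q x
    <= C * `|Uint u 0 x / L x|.

(* [Q] and [L] are meant to be a small power of [x] and a power of [log x].
   What is used of this: away from [x = 1] the error term of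
   [arithmetical_sequence] is defined, and up to a constant it is
   nondecreasing.  For arbitrary real functions [Q] and [L] nothing would
   control the mass of [f] on the initial segments of [1, x] in terms of the
   error at [x]. *)
Definition regular_scale u Q L : Prop :=
  (forall x : K, 2 <= x -> 0 < L x /\ 1 < Q x) /\
  (exists C : K, forall x y : K, 2 <= y -> y <= x ->
     as_error u Q L y <= C * as_error u Q L x).

Definition hmu h (j r : nat) : K :=
  dconv (h j) (fun n => (moebius n)%:~R) r.

Definition FR J h u R (n : nat) : K :=
  \sum_(0 <= j < J) u j n%:R *
    \sum_(1 <= r < (Num.truncn R).+1)
      hmu h j r / (totient (r %/ gcdn r n))%:R *
      (moebius (r %/ gcdn r n))%:~R.

(* Sum of [g n] over the positive integers [n] with [a < n <= x] and
   [n] congruent to [a] mod [q]; [a] may be negative. *)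
Definition ap_sum (g : nat -> K) x (q : nat) (a : int) : K :=
  \sum_(1 <= n < (Num.truncn x).+1
          | (a < n%:Z) && (n%:Z == a %[mod q%:Z])%Z) g n.

Definition rho_star J h u R x (q : nat) (a : int) : K :=
  ap_sum (FR J h u R) x q a.

Definition u1_star J h u x R : K :=
  \sum_(0 <= j < J) (`|u j x| + 1) *
    \sum_(1 <= r < (Num.truncn R).+1) `|hmu h j r| * r%:R / (totient r)%:R.

End Data.

(* Main.v *)
Require Import Defs.
From mathcomp Require Import all_boot all_order all_algebra all_solvable.
From mathcomp Require Import all_classical all_reals all_analysis.
From mathcomp Require Import zify ring lra.
Set Implicit Arguments.
Unset Strict Implicit.
Unset Printing Implicit Defensive.
Import Order.TTheory GRing.Theory Num.Theory.
Import numFieldNormedType.Exports.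
Local Open Scope ring_scope.

(** Write [S(F; y; m, b)] for the sum of [F n] over [1 <= n <= y] with [n]
    congruent to [b] modulo [m]. A modulus [q > x / N] dividing [n - a] has a
    small cofactor: [n - a = q m] with [m < N (1 - a / x)], hence [m < N + 1],
    and even [m < N] if [a > 0]. Exchanging [q] and [m] turns the sum over the
    moduli [q > x / N] into a sum over [m <= M] of differences
    [S(f - F_R; hi m; m, a) - S(f - F_R; lo m; m, a)], where [0 <= lo m <= hi m <= x]
    and [M <= min (Q x, R)] (lemma [sum_switch]). The sum over the moduli
    [q <= N] has this shape from the start. So everything reduces to one bound,
    summed over [m <= M], for [S(f - F_R; y; m, b)] with [y <= x] and [m <= R];
    this is [one_modulus_error].

    For the model, [moebius s / totient s] with [s = r / gcd (r, n)] equals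
    [c_r(n) / totient r], where [c_r(n)] is the sum of [d * moebius (r / d)]
    over the common divisors [d] of [r] and [n]. For each [d] the conditions
    [n = b (mod m)] and [d | n] define, if compatible, one class modulo
    [lcm (d, m)], over which a monotone [u_j] sums to [U_j(y) / lcm (d, m)] up
    to a multiple of [|u_j(0)| + |u_j(x)|]. The main terms vanish unless [r | m],
    because a function of [gcd (d, m)], convolved with the Moebius function, is
    supported on the divisors of [m]; for each [r], before the division by
    [totient r], the error is at most a constant times
    [sum_(d | r) d <= r (1 + log R)] times [|u_j(0)| + |u_j(x)|].
    This gives [FR_ap_sum].

    For [f], equidistribution replaces the class [b] by the average over the
    classes with the same gcd [g] with [m], and Moebius inversion writes this
    average with the sums of [f] over the multiples of [d g], for [d | m / g],
    known from the hypothesis on the sequence. The two main terms coincide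
    ([main_term_eq]). The number of errors, divided by [totient (m / g)], is
    [tau_phi (m / g)]; summed over [m <= Q] this is at most
    [tau (|a|) * (sum_(d <= Q) 1 / totient d) ^ 2], which is
    [O (tau (|a|) (log Q) ^ 2)] and absorbs the saving [(log Q) ^ 2] of the
    hypothesis. *)

(** * Sums over divisors *)

Section DivisorSums.
Variable V : zmodType.
Implicit Types (F : nat -> V) (n d k r B : nat).

Lemma sum_divisors_mkcond n F (P : pred nat) : (0 < n)%N ->
  \sum_(d <- divisors n | P d) F d =
  \sum_(1 <= d < n.+1 | (d %| n)%N && P d) F d.
Proof.
move=> n0; rewrite -big_filter -[RHS]big_filter; apply: perm_big.
apply: uniq_perm; first by rewrite filter_uniq ?divisors_uniq.
  by rewrite filter_uniq ?iota_uniq.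
move=> d; rewrite !mem_filter -dvdn_divisors // mem_index_iota ltnS.
rewrite andbC -andbA; case dn: (d %| n)%N => //=.
by rewrite (dvdn_gt0 n0 dn) (dvdn_leq n0 dn) /= andbT.
Qed.

Lemma sum_divisors_range n B F : (0 < n)%N -> (n < B)%N ->
  \sum_(d <- divisors n) F d = \sum_(1 <= d < B | (d %| n)%N) F d.
Proof.
move=> n0 nB; rewrite (sum_divisors_mkcond F xpredT) //.
under eq_bigl => d do rewrite andbT.
rewrite [RHS](big_cat_nat _ nB) //= [X in _ + X]big1_seq ?addr0 // => d.
rewrite mem_index_iota => /andP[dn /andP[nd _]].
by move: (dvdn_leq n0 dn); lia.
Qed.

Lemma sum_divisors_sub n d F : (0 < n)%N -> (d %| n)%N ->
  \sum_(e <- divisors d) F e = \sum_(e <- divisors n | (e %| d)%N) F e.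
Proof.
move=> n0 dn; have d0 := dvdn_gt0 n0 dn; rewrite -[RHS]big_filter.
apply: perm_big; apply: uniq_perm; rewrite ?filter_uniq ?divisors_uniq // => e.
rewrite mem_filter -!dvdn_divisors //.
by case ed: (e %| d)%N => //=; rewrite (dvdn_trans ed dn).
Qed.

Lemma sum_divisors_mul n d F : (0 < n)%N -> (d %| n)%N ->
  \sum_(r <- divisors n | (d %| r)%N) F r =
  \sum_(k <- divisors (n %/ d)) F (d * k)%N.
Proof.
move=> n0 dn; have d0 := dvdn_gt0 n0 dn.
rewrite -big_filter -(big_map (muln d) xpredT F).
apply: perm_big; apply: uniq_perm; first by rewrite filter_uniq ?divisors_uniq.
  rewrite map_inj_uniq ?divisors_uniq // => x y /eqP.
  by rewrite eqn_pmul2l // => /eqP.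
have nd0 : (0 < n %/ d)%N by rewrite divn_gt0 // dvdn_leq.
move=> r; rewrite mem_filter -dvdn_divisors //; apply/andP/mapP.
  case=> /dvdnP[k ->] kn; exists k; last by rewrite mulnC.
  by rewrite -dvdn_divisors // dvdn_divRL.
case=> k; rewrite -dvdn_divisors // dvdn_divRL // mulnC => kn ->.
by rewrite dvdn_mulr.
Qed.

Lemma sum_divisors_flip n F : (0 < n)%N ->
  \sum_(d <- divisors n) F (n %/ d)%N = \sum_(d <- divisors n) F d.
Proof.
move=> n0; rewrite -(big_map (fun d => n %/ d)%N xpredT F); apply: perm_big.
have inv d : (d %| n)%N -> (n %/ (n %/ d))%N = d.
  by move=> dn; rewrite divnA // mulKn.
apply: uniq_perm; rewrite ?divisors_uniq //.
  rewrite map_inj_in_uniq ?divisors_uniq // => x y.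
  rewrite -!dvdn_divisors // => xn yn e.
  by rewrite -(inv _ xn) -(inv _ yn) e.
move=> d; rewrite -dvdn_divisors //; apply/mapP/idP.
  by case=> e; rewrite -dvdn_divisors // => en ->; rewrite dvdn_div.
move=> dn; exists (n %/ d)%N; last by rewrite inv.
by rewrite -dvdn_divisors // dvdn_div.
Qed.

(** A sum over the triples of factors [d * k * e = n], ordered in two ways. *)
Lemma sum_divisors_assoc n (F : nat -> nat -> V) : (0 < n)%N ->
  \sum_(r <- divisors n) \sum_(d <- divisors r) F d (r %/ d)%N =
  \sum_(d <- divisors n) \sum_(k <- divisors (n %/ d)) F d k.
Proof.
move=> n0.
transitivity (\sum_(r <- divisors n) \sum_(d <- divisors n | (d %| r)%N)
                F d (r %/ d)%N).
  rewrite !big_seq; apply: eq_bigr => r; rewrite -dvdn_divisors // => rn.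
  exact: sum_divisors_sub.
rewrite (exchange_big_dep xpredT) //= !big_seq; apply: eq_bigr => d.
rewrite -dvdn_divisors // => dn; rewrite sum_divisors_mul //.
by apply: eq_bigr => k _; rewrite mulKn // (dvdn_gt0 n0).
Qed.

Lemma sum_divisors_exchange n (F : nat -> nat -> V) : (0 < n)%N ->
  \sum_(d <- divisors n) \sum_(e <- divisors (n %/ d)) F d e =
  \sum_(e <- divisors n) \sum_(d <- divisors (n %/ e)) F d e.
Proof.
move=> n0.
have H (G : nat -> nat -> V) :
  \sum_(d <- divisors n) \sum_(e <- divisors (n %/ d)) G d e =
  \sum_(d <- divisors n) \sum_(e <- divisors n | (d * e %| n)%N) G d e.
  rewrite !big_seq; apply: eq_bigr => d; rewrite -dvdn_divisors // => dn.
  rewrite (@sum_divisors_sub n) ?dvdn_div //; apply: eq_bigl => e.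
  by rewrite dvdn_divRL // mulnC.
rewrite H (H (fun e d => F d e)) (exchange_big_dep xpredT) //=.
by apply: eq_bigr => d _; apply: eq_bigl => e; rewrite mulnC.
Qed.

(** The sum over the [n < B] and their divisors [d], ordered by [d] and by
    the cofactor [k = n / d]. *)
Lemma sum_range_dvd B (F : nat -> nat -> V) :
  \sum_(1 <= n < B) \sum_(d <- divisors n) F d (n %/ d)%N =
  \sum_(1 <= d < B) \sum_(1 <= k < B | (d * k < B)%N) F d k.
Proof.
transitivity (\sum_(1 <= n < B) \sum_(1 <= d < B | (d %| n)%N) F d (n %/ d)%N).
  rewrite !big_nat; apply: eq_bigr => n /andP[n0 nB].
  exact: (sum_divisors_range (fun d => F d (n %/ d)%N)).
rewrite (exchange_big_dep xpredT) //= !big_nat; apply: eq_bigr => d /andP[d0 _].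
rewrite -big_filter -[RHS]big_filter.
transitivity (\sum_(n <- [seq (d * k)%N | k <- [seq k <- index_iota 1 B
                | (d * k < B)%N]]) F d (n %/ d)%N); last first.
  by rewrite big_map; apply: eq_bigr => k _; rewrite mulKn.
apply: perm_big; apply: uniq_perm; first by rewrite filter_uniq ?iota_uniq.
  rewrite map_inj_uniq ?filter_uniq ?iota_uniq // => x y /eqP.
  by rewrite eqn_pmul2l // => /eqP.
move=> n; rewrite mem_filter mem_index_iota; apply/andP/mapP.
  case=> /dvdnP[k ->] /andP[k0 kB]; exists k; last by rewrite mulnC.
  by rewrite mem_filter mem_index_iota mulnC kB /=; move: k0 kB d0; nia.
case=> k; rewrite mem_filter mem_index_iota => /and3P[dk k0 kB] ->.
by rewrite dvdn_mulr //; split => //; rewrite dk andbT muln_gt0 d0.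
Qed.

End DivisorSums.

(** * The Moebius function *)

Lemma moebius1 : moebius 1 = 1.
Proof. by rewrite /moebius /=. Qed.

Lemma moebius_primeM p d : prime p -> (0 < d)%N ->
  moebius (p * d) = if (p %| d)%N then 0 else - moebius d.
Proof.
move=> pp d0; have p0 := prime_gt0 pp.
rewrite /moebius muln_gt0 p0 d0 /=; case: (boolP (p %| d)%N) => pd.
  rewrite ifN //.
  apply/allPn; exists p; first by rewrite mem_primes pp muln_gt0 p0 d0 dvdn_mulr.
  rewrite lognM // logn_prime // eqxx.
  by have : (0 < logn p d)%N; [rewrite logn_gt0 mem_primes pp d0 | lia].
have pm : perm_eq (primes (p * d)) (p :: primes d).
  apply: uniq_perm; rewrite ?primes_uniq //=.
    by rewrite primes_uniq andbT mem_primes pp d0.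
  by move=> q; rewrite primesM // primes_prime // !inE.
rewrite (perm_size pm) /= (perm_all _ pm) /=.
have -> : (logn p (p * d) == 1)%N.
  by rewrite lognM // logn_prime // eqxx lognE pp d0 (negbTE pd).
rewrite /= exprS mulN1r.
have -> : all (fun q => logn q (p * d) == 1%N) (primes d) =
          all (fun q => logn q d == 1%N) (primes d).
  apply: eq_in_all => q; rewrite mem_primes => /and3P[qq _ qd].
  rewrite lognM // logn_prime //; case: (eqVneq q p) => // e.
  by rewrite -e qd in pd.
by case: ifP; rewrite ?oppr0.
Qed.

Lemma moebius_sqr_dvd p d : prime p -> (0 < d)%N -> (p * p %| d)%N ->
  moebius d = 0.
Proof.
move=> pp d0 /dvdnP[k dk].
have -> : d = (p * (p * k))%N by rewrite dk; lia.
rewrite moebius_primeM ?dvdn_mulr //; move: d0; rewrite dk; nia.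
Qed.

Lemma totient_primeM p n : prime p -> (0 < n)%N ->
  totient (p * n) = ((if (p %| n)%N then p else p.-1) * totient n)%N.
Proof.
move=> pp n0; case: ifPn => pn; last first.
  by rewrite totient_coprime ?prime_coprime // totient_prime.
have [k npk co] := pfactor_coprime pp n0.
have l0 : (0 < logn p n)%N by rewrite logn_gt0 mem_primes pp n0.
have cX e : coprime (p ^ e) k by rewrite coprimeXl.
have -> : (p * n = p ^ (logn p n).+1 * k)%N by rewrite expnS -mulnA [(_ ^ _ * k)%N]mulnC -co.
rewrite [in totient n]co [(k * _)%N]mulnC !totient_coprime //.
rewrite !totient_pfactor //=; case: (logn p n) l0 => //= l _.
by rewrite expnS; lia.
Qed.

Lemma totient_supermul d e : (0 < d)%N -> (0 < e)%N ->
  (totient d * totient e <= totient (d * e))%N.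
Proof.
move=> d0; elim/ltn_ind: e => e IH e0.
have [e1|e1] := leqP e 1%N.
  by have -> : e = 1%N by [lia]; rewrite /= !muln1.
have pp := pdiv_prime e1; set p := pdiv e in pp.
have pe : (p %| e)%N := pdiv_dvd e.
have E : e = (p * (e %/ p))%N by rewrite mulnC divnK.
move: E; set e' := (e %/ p)%N => E.
have e'0 : (0 < e')%N by move: e0; rewrite E muln_gt0 => /andP[].
have e'e : (e' < e)%N by rewrite E ltn_Pmull ?prime_gt1.
rewrite E mulnCA !(totient_primeM pp) ?muln_gt0 ?d0 //.
rewrite mulnCA; apply: leq_mul; last exact: IH.
case: ifP => [pe'|_]; first by rewrite dvdn_mull.
by case: ifP => // _; exact: leq_pred.
Qed.

(** * Moebius sums *)

Section MoebiusSums.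
Variable K : realFieldType.
Implicit Types (F : nat -> K) (n d k r s p m : nat).
Local Notation mu n := ((moebius n)%:~R : K).

Lemma sum_moebius_dvd_prime p n F : prime p -> (0 < n)%N -> (p %| n)%N ->
  \sum_(d <- divisors n | (p %| d)%N) mu d * F d =
  - \sum_(d <- divisors n | ~~ (p %| d)%N) mu d * F (p * d)%N.
Proof.
move=> pp n0 pn; have p0 := prime_gt0 pp.
rewrite (sum_divisors_mul (fun d => mu d * F d)) // (bigID (dvdn p)) /=.
have np0 : (0 < n %/ p)%N by rewrite divn_gt0 // dvdn_leq.
rewrite big1_seq ?add0r; last first.
  move=> k /andP[pk]; rewrite -dvdn_divisors // => kn.
  by rewrite moebius_primeM ?pk ?mul0r // (dvdn_gt0 np0).
rewrite -sumrN -big_filter -[RHS]big_filter.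
have E : [seq d <- divisors (n %/ p) | ~~ (p %| d)%N] =i
         [seq d <- divisors n | ~~ (p %| d)%N].
  move=> d; rewrite !mem_filter -!dvdn_divisors //.
  case: (boolP (p %| d)%N) => //= pd.
  by rewrite dvdn_divRL // mulnC Gauss_dvd ?prime_coprime // pn.
rewrite [LHS](perm_big [seq d <- divisors n | ~~ (p %| d)%N]) /=.
  rewrite !big_filter big_seq_cond [RHS]big_seq_cond; apply: eq_bigr => d.
  rewrite -dvdn_divisors // => /andP[dn pd].
  by rewrite moebius_primeM ?(negbTE pd) ?(dvdn_gt0 n0) // rmorphN mulNr.
by apply: uniq_perm; rewrite ?filter_uniq ?divisors_uniq.
Qed.

(** Pairing the divisors [d] and [p * d], for a prime [p] not dividing [d]: all
    the Moebius identities below come from this one. *)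
Lemma sum_moebius_split p n F : prime p -> (0 < n)%N -> (p %| n)%N ->
  \sum_(d <- divisors n) mu d * F d =
  \sum_(d <- divisors n | ~~ (p %| d)%N) mu d * (F d - F (p * d)%N).
Proof.
move=> pp n0 pn; rewrite (bigID (dvdn p)) /= sum_moebius_dvd_prime //.
rewrite addrC -sumrB; apply: eq_bigr => d _.
by rewrite mulrBr.
Qed.

Lemma sum_moebius n : (0 < n)%N ->
  \sum_(d <- divisors n) mu d = (n == 1%N)%:R.
Proof.
move=> n0; case: (eqVneq n 1%N) => [->|n1].
  by rewrite (_ : divisors 1 = [:: 1%N]) // big_seq1 moebius1.
have pp : prime (pdiv n) by apply: pdiv_prime; lia.
transitivity (\sum_(d <- divisors n) mu d * 1).
  by apply: eq_bigr => d _; rewrite mulr1.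
rewrite (sum_moebius_split (fun _ => 1) pp n0 (pdiv_dvd n)).
by rewrite big1 // => d _; rewrite subrr mulr0.
Qed.

Lemma sum_moebius_coprime n k : (0 < k)%N ->
  \sum_(d <- divisors k | (d %| n)%N) mu d = (coprime k n)%:R.
Proof.
move=> k0; rewrite /coprime -sum_moebius ?gcdn_gt0 ?k0 //.
rewrite [RHS](sum_divisors_sub _ k0 (dvdn_gcdl k n)).
rewrite big_seq_cond [RHS]big_seq_cond; apply: eq_bigl => d.
by rewrite -dvdn_divisors // dvdn_gcd; case: (d %| k)%N.
Qed.

Lemma sum_totient_divisors n : (0 < n)%N ->
  \sum_(d <- divisors n) (totient d)%:R = n%:R :> K.
Proof.
move=> n0; rewrite -{2}(sum_totient_dvd n) natr_sum.
rewrite (@sum_divisors_range _ n n.+1) //.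
rewrite -(big_mkord (fun d => d %| n)%N (fun d => (totient d)%:R)).
rewrite [RHS]big_mkcond [RHS]big_ltn //.
by rewrite dvd0n eqn0Ngt n0 /= add0r -big_mkcond.
Qed.

Lemma totient_moebius n : (0 < n)%N ->
  \sum_(d <- divisors n) mu d / d%:R = (totient n)%:R / n%:R.
Proof.
move=> n0; have nn0 : n%:R != 0 :> K by rewrite pnatr_eq0 -lt0n.
apply: (mulIf nn0); rewrite divfK // mulr_suml.
transitivity (\sum_(d <- divisors n) \sum_(e <- divisors (n %/ d))
                mu d * (totient e)%:R).
  rewrite !big_seq; apply: eq_bigr => d; rewrite -dvdn_divisors // => dn.
  have d0 := dvdn_gt0 n0 dn; have dd0 : d%:R != 0 :> K by rewrite pnatr_eq0 -lt0n.
  have q0 : (0 < n %/ d)%N by rewrite divn_gt0 // dvdn_leq.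
  rewrite -mulr_sumr sum_totient_divisors //.
  rewrite -{1}(divnK dn) natrM -mulrA; congr (_ * _).
  by rewrite mulrC mulfK.
rewrite sum_divisors_exchange // (bigD1_seq n) ?divisors_uniq ?divisors_id //=.
rewrite divnn n0 (_ : divisors 1 = [:: 1%N]) // big_seq1 moebius1 mul1r.
rewrite big1_seq ?addr0 // => e /andP[en]; rewrite -dvdn_divisors // => edn.
rewrite -mulr_suml sum_moebius; last by rewrite divn_gt0 ?(dvdn_gt0 n0 edn) // dvdn_leq.
have -> : (n %/ e == 1)%N = false; last by rewrite mul0r.
apply/negbTE; apply: contra en => /eqP e1.
by rewrite -(divnK edn) e1 mul1n.
Qed.

(** Restriction of the formula for [totient k / k] to the multiples of [s].
    Induction on the primes of [s], comparing the sums for [t] and for [p * t]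
    by [sum_moebius_split]. *)
Lemma sum_moebius_multiples k s : (0 < k)%N -> (s %| k)%N ->
  \sum_(d <- divisors k | (s %| d)%N) mu d / d%:R =
  mu s * (totient k)%:R / (k%:R * (totient s)%:R).
Proof.
move=> k0; elim/ltn_ind: s => s IH sk.
have s0 := dvdn_gt0 k0 sk.
have [s1|s1] := leqP s 1%N.
  have -> : s = 1%N by lia.
  rewrite moebius1 mul1r mulr1 -totient_moebius //.
  by apply: eq_bigl => d; rewrite dvd1n.
have [p pp ps] : exists2 p, prime p & (p %| s)%N.
  by exists (pdiv s); rewrite ?pdiv_prime ?pdiv_dvd.
have p0 := prime_gt0 pp; have p1 := prime_gt1 pp.
have [t E] : exists t, s = (p * t)%N.
  by exists (s %/ p)%N; rewrite mulnC divnK.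
have t0 : (0 < t)%N by move: s0; rewrite E muln_gt0 => /andP[].
have ts : (t < s)%N by rewrite E ltn_Pmull.
have tk : (t %| k)%N by apply: dvdn_trans sk; rewrite E dvdn_mull.
have pk : (p %| k)%N by apply: dvdn_trans sk; rewrite E dvdn_mulr.
case: (boolP (p %| t)%N) => pt.
  have -> : moebius s = 0 by rewrite E moebius_primeM ?pt.
  rewrite !mul0r big1_seq // => d /andP[sd]; rewrite -dvdn_divisors // => dk.
  rewrite (@moebius_sqr_dvd p) ?mul0r ?(dvdn_gt0 k0 dk) //.
  by apply: dvdn_trans sd; rewrite E dvdn_mul.
have IHt := IH t ts tk.
(* Both sums are multiples of [S], the part coming from [d] prime to [p]. *)
pose S := \sum_(d <- divisors k | ~~ (p %| d)%N) mu d * ((t %| d)%N%:R / d%:R).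
have D r : \sum_(d <- divisors k | (r %| d)%N) mu d / d%:R =
    \sum_(d <- divisors k) mu d * ((r %| d)%N%:R / d%:R).
  rewrite big_mkcond; apply: eq_bigr => d _.
  by case: (r %| d)%N; rewrite ?mul1r ?mul0r ?mulr0.
have pK0 : p%:R != 0 :> K by rewrite pnatr_eq0 -lt0n.
have Et : \sum_(d <- divisors k | (t %| d)%N) mu d / d%:R = S * (1 - p%:R^-1).
  rewrite D (sum_moebius_split _ pp k0 pk) mulr_suml big_seq_cond [RHS]big_seq_cond.
  apply: eq_bigr => d; rewrite -dvdn_divisors // => /andP[dk pd].
  rewrite Gauss_dvdr; last by rewrite coprime_sym prime_coprime.
  have d0 : d%:R != 0 :> K by rewrite pnatr_eq0 -lt0n (dvdn_gt0 k0 dk).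
  rewrite natrM /=; move: (mu d) ((t %| d)%N%:R : K) => b c; field.
  by rewrite d0 pK0.
have Es : \sum_(d <- divisors k | (s %| d)%N) mu d / d%:R = - S * p%:R^-1.
  rewrite D (sum_moebius_split _ pp k0 pk) mulNr mulr_suml -sumrN big_seq_cond [RHS]big_seq_cond.
  apply: eq_bigr => d; rewrite -dvdn_divisors // => /andP[dk pd].
  rewrite E dvdn_pmul2l //.
  have -> : (p * t %| d)%N = false.
    by apply: contraNF pd; apply: dvdn_trans; rewrite dvdn_mulr.
  have d0 : d%:R != 0 :> K by rewrite pnatr_eq0 -lt0n (dvdn_gt0 k0 dk).
  rewrite natrM /=; move: (mu d) ((t %| d)%N%:R : K) => b c; field.
  by rewrite d0 pK0.
have p1K : p%:R - 1 != 0 :> K.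
  by rewrite subr_eq0 pnatr_eq1; lia.
have -> : (totient s)%:R = (p%:R - 1) * (totient t)%:R :> K.
  rewrite E totient_primeM // (negbTE pt) natrM -subn1 natrB //.
have -> : mu s = - mu t by rewrite E moebius_primeM // (negbTE pt) rmorphN.
have kK : k%:R != 0 :> K by rewrite pnatr_eq0 -lt0n.
have tK : (totient t)%:R != 0 :> K by rewrite pnatr_eq0 -lt0n totient_gt0.
rewrite Es.
have -> : S = mu t * (totient k)%:R / (k%:R * (totient t)%:R) / (1 - p%:R^-1).
  rewrite -IHt Et mulfK //.
  by rewrite -{1}(divff pK0) -[X in _ - X]mul1r -mulrBl mulf_neq0 ?invr_neq0.
field.
by rewrite pK0 p1K kK tK.
Qed.

(** The quotient [moebius s / totient s], with [s = r / gcd (r, n)], is the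
    Ramanujan sum [c_r(n)] divided by [totient r] (Hoelder's formula). *)
Lemma ramanujan_sum r n : (0 < r)%N ->
  \sum_(d <- divisors r | (d %| n)%N) d%:R * mu (r %/ d)%N =
  (totient r)%:R * (mu (r %/ gcdn r n)%N / (totient (r %/ gcdn r n))%:R).
Proof.
move=> r0; set s := (r %/ gcdn r n)%N.
have g0 : (0 < gcdn r n)%N by rewrite gcdn_gt0 r0.
have sr : (s %| r)%N by rewrite dvdn_div ?dvdn_gcdl.
have s0 := dvdn_gt0 r0 sr.
(* With [d] replaced by [r / d], the condition [r / d | n] becomes [s | d]. *)
rewrite big_mkcond -sum_divisors_flip //=.
transitivity (r%:R * \sum_(d <- divisors r | (s %| d)%N) mu d / d%:R).
  rewrite mulr_sumr [RHS]big_mkcond !big_seq; apply: eq_bigr => d.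
  rewrite -dvdn_divisors // => dr; have d0 := dvdn_gt0 r0 dr.
  have -> : (r %/ d %| n)%N = (s %| d)%N.
    transitivity (r %/ d %| gcdn r n)%N; first by rewrite dvdn_gcd dvdn_div.
    rewrite /s -[RHS](dvdn_pmul2r g0) divnK ?dvdn_gcdl //.
    by rewrite -[LHS](dvdn_pmul2r d0) divnK // mulnC.
  case: ifP => // _.
  rewrite divnA // mulKn //.
  have dK : d%:R != 0 :> K by rewrite pnatr_eq0 -lt0n.
  rewrite -{2}(divnK dr) natrM; field.
  exact: dK.
rewrite sum_moebius_multiples //.
have rK : r%:R != 0 :> K by rewrite pnatr_eq0 -lt0n.
have sK : (totient s)%:R != 0 :> K by rewrite pnatr_eq0 -lt0n totient_gt0.
field.
by rewrite rK sK.
Qed.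

(** If [r] does not divide [m], some prime [p] is more frequent in [r] than in
    [m]; then [gcd (r / d, m)] does not change when [d] is multiplied by [p],
    and the terms cancel in pairs. *)
Lemma moebius_gcd_eq0 m r F : (0 < r)%N -> (0 < m)%N -> ~~ (r %| m)%N ->
  \sum_(d <- divisors r) F (gcdn d m) * mu (r %/ d)%N = 0.
Proof.
move=> r0 m0 rm.
have [p pp pl] : exists2 p, prime p & (logn p m < logn p r)%N.
  apply/not_exists2P => H; case/negP: rm.
  apply/(dvdn_partP _ r0) => p; rewrite mem_primes => /and3P[pp _ _].
  rewrite p_part pfactor_dvdn //.
  by case: (H p) => // /negP; rewrite -leqNgt.
have pr : (p %| r)%N by have := leq_ltn_trans (leq0n _) pl; rewrite logn_gt0 mem_primes => /and3P[].
rewrite -sum_divisors_flip //=.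
transitivity (\sum_(d <- divisors r) mu d * F (gcdn (r %/ d) m)).
  rewrite !big_seq; apply: eq_bigr => d; rewrite -dvdn_divisors // => dr.
  by rewrite divnA // mulKn // mulrC.
rewrite (sum_moebius_split (fun d => F (gcdn (r %/ d) m)) pp r0 pr).
rewrite big1_seq // => d /andP[pd]; rewrite -dvdn_divisors // => dr.
have d0 := dvdn_gt0 r0 dr; have p0 := prime_gt0 pp.
suff -> : gcdn (r %/ (p * d)) m = gcdn (r %/ d) m by rewrite subrr mulr0.
have pdr : (p * d %| r)%N by rewrite Gauss_dvd ?prime_coprime // pr dr.
have [t Et] := dvdnP pdr.
have t0 : (0 < t)%N by move: r0; rewrite Et muln_gt0 => /andP[].
have -> : (r %/ (p * d) = t)%N by rewrite Et mulnK // muln_gt0 p0 d0.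
have -> : (r %/ d = t * p)%N by rewrite Et mulnA mulnK.
have tl : (logn p m <= logn p t)%N.
  move: pl; rewrite Et !lognM ?muln_gt0 ?p0 ?d0 // (logn_prime p pp) eqxx.
  by rewrite (lognE p d) (negbTE pd) !andbF; lia.
apply/eqP; rewrite eqn_dvd !dvdn_gcd !dvdn_gcdr !andbT.
rewrite (dvdn_trans (dvdn_gcdl _ _)) ?dvdn_mulr //=.
have g0 : (0 < gcdn (t * p) m)%N by rewrite gcdn_gt0 m0 orbT.
apply/(dvdn_partP _ g0) => q; rewrite mem_primes => /and3P[qp _ _].
rewrite p_part pfactor_dvdn //.
have gm : (logn q (gcdn (t * p) m) <= logn q m)%N.
  by rewrite dvdn_leq_log // dvdn_gcdr.
have gt : (logn q (gcdn (t * p) m) <= logn q (t * p))%N.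
  by rewrite dvdn_leq_log ?dvdn_gcdl // muln_gt0 t0 p0.
case: (eqVneq q p) => [eqp|qp'].
  by rewrite eqp in gm *; exact: leq_trans gm tl.
move: gt; rewrite lognM // (logn_prime q pp) (negbTE qp') addn0.
by [].
Qed.

Lemma moebius_gcd_sum m r F : (0 < r)%N -> (0 < m)%N ->
  \sum_(d <- divisors r) F (gcdn d m) * mu (r %/ d)%N =
  (r %| m)%N%:R * \sum_(d <- divisors r) F d * mu (r %/ d)%N.
Proof.
move=> r0 m0; case: (boolP (r %| m)%N) => rm; last by rewrite mul0r moebius_gcd_eq0.
rewrite mul1r !big_seq; apply: eq_bigr => d; rewrite -dvdn_divisors // => dr.
by have /gcdn_idPl -> := dvdn_trans dr rm.
Qed.

End MoebiusSums.

(** Moebius inversion: [h j] is the sum over divisors of [h j * moebius]. *)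
Lemma sum_hmu (K : realType) (h : nat -> nat -> K) j e : (0 < e)%N ->
  \sum_(r <- divisors e) hmu h j r = h j e.
Proof.
move=> e0; rewrite /hmu /dconv.
rewrite (sum_divisors_assoc (fun d k => h j d * (moebius k)%:~R)) //.
rewrite (bigD1_seq e) ?divisors_uniq ?divisors_id //=.
rewrite divnn e0 (_ : divisors 1 = [:: 1%N]) // big_seq1 moebius1 mulr1.
rewrite big1_seq ?addr0 // => d /andP[de]; rewrite -dvdn_divisors // => dn.
rewrite -mulr_sumr sum_moebius; last by rewrite divn_gt0 ?(dvdn_gt0 e0 dn) // dvdn_leq.
have -> : (e %/ d == 1)%N = false; last by rewrite mulr0.
apply/negbTE; apply: contra de => /eqP e1.
by rewrite -(divnK dn) e1 mul1n.
Qed.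

(** * Harmonic sums weighted by the totient *)

Section TotientSums.
Variable K : realType.
Implicit Types (n d k m p B : nat) (w : nat -> K).

Lemma ler_sum_subset (I : eqType) (r : seq I) (P1 P2 : pred I) (F : I -> K) :
  (forall i, i \in r -> P1 i -> P2 i) -> (forall i, i \in r -> P2 i -> 0 <= F i) ->
  \sum_(i <- r | P1 i) F i <= \sum_(i <- r | P2 i) F i.
Proof.
move=> P12 F0; rewrite big_mkcond [leRHS]big_mkcond big_seq [leRHS]big_seq.
apply: ler_sum => i ir; case: ifPn => [/(P12 _ ir)->//|_].
by case: ifP => // /(F0 _ ir).
Qed.

(** The sum of the divisors of [n], divided by [n]. *)
Definition sum_inv_divisors n : K := \sum_(d <- divisors n) d%:R^-1.

Lemma sum_inv_divisors_prime_pow p k n : prime p -> (0 < k)%N -> (0 < n)%N ->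
  ~~ (p %| n)%N ->
  (1 + p%:R^-1) * sum_inv_divisors n <= sum_inv_divisors (p ^ k * n).
Proof.
move=> pp k0 n0 pn; have p0 := prime_gt0 pp.
have N0 : (0 < p ^ k * n)%N by rewrite muln_gt0 expn_gt0 p0.
have pN : (p %| p ^ k * n)%N by rewrite dvdn_mulr // dvdn_exp.
rewrite /sum_inv_divisors [leRHS](bigID (dvdn p)) /= addrC mulrDl mul1r.
apply: lerD.
  rewrite (sum_divisors_sub _ N0 (dvdn_mull _ (dvdnn n))).
  apply: ler_sum_subset => // d _ dn; apply: contra pn => pd.
  exact: dvdn_trans pd dn.
rewrite (sum_divisors_mul (fun d => d%:R^-1)) //.
have nN : (n %| (p ^ k * n) %/ p)%N.
  by case: (k) k0 => // k' _; rewrite expnS -mulnA mulKn // dvdn_mull.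
have q0 : (0 < (p ^ k * n) %/ p)%N by rewrite divn_gt0 // dvdn_leq.
rewrite (sum_divisors_sub _ q0 nN) mulr_sumr.
apply: le_trans (_ : \sum_(e <- divisors ((p ^ k * n) %/ p)) p%:R^-1 * e%:R^-1 <= _).
  by apply: ler_sum_subset => // d _ _; rewrite mulr_ge0 ?invr_ge0.
by apply: ler_sum => d _; rewrite natrM invfM.
Qed.

Lemma sum_inv_divisors_ge0 n : 0 <= sum_inv_divisors n.
Proof. by apply: sumr_ge0 => d _; rewrite invr_ge0. Qed.

(** Induction on a bound [P] for the prime factors of [n]: removing the prime
    [P] costs a factor [1 - P ^ -2], and the product of these factors
    telescopes. *)
Lemma totient_sum_inv_divisors_ge P n : (0 < P)%N -> (0 < n)%N ->
  (forall p, prime p -> (p %| n)%N -> (p <= P)%N) ->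
  2^-1 * (1 + P%:R^-1) <= (totient n)%:R / n%:R * sum_inv_divisors n.
Proof.
elim: P n => // P IH n _ n0 nP.
have [P0|P0] := posnP P.
  have n1 : n = 1%N.
    apply/eqP; rewrite eqn_leq n0 andbT leqNgt; apply/negP => n1.
    have := nP _ (pdiv_prime n1) (pdiv_dvd n).
    by have := prime_gt1 (pdiv_prime n1); rewrite P0; lia.
  rewrite n1 P0 /sum_inv_divisors (_ : divisors 1 = [:: 1%N]) // big_seq1.
  by rewrite /totient /= invr1; lra.
have PK : 0 < P%:R :> K by rewrite ltr0n.
have [/andP[pp pn]|npn] := boolP (prime P.+1 && (P.+1 %| n)%N); last first.
  (* [P + 1] is no prime factor of [n]: the bound for [P] is stronger. *)
  apply: (@le_trans _ _ (2^-1 * (1 + P%:R^-1))).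
    rewrite ler_pM2l ?invr_gt0 ?ltr0n // lerD2l lef_pV2 ?posrE ?ltr0n //.
    by rewrite ler_nat.
  apply: IH => // p pp pn; have := nP p pp pn; rewrite leq_eqVlt => /orP[/eqP pE|//].
  by move: npn; rewrite -pE pp pn.
have [k co E] := pfactor_coprime pp n0.
have l0 : (0 < logn P.+1 n)%N by rewrite logn_gt0 mem_primes pp n0.
move: (logn P.+1 n) l0 E => l l0 E.
have k0 : (0 < k)%N by move: n0; rewrite E muln_gt0 => /andP[].
have pk : ~~ (P.+1 %| k)%N by rewrite -prime_coprime.
have kP p : prime p -> (p %| k)%N -> (p <= P)%N.
  move=> pp' pk'; have := nP p pp'; rewrite E dvdn_mulr // => /(_ isT).
  by rewrite leq_eqVlt => /orP[/eqP pE|//]; rewrite -pE pk' in pk.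
have {IH} := IH k P0 k0 kP.
have := sum_inv_divisors_prime_pow pp l0 k0 pk.
rewrite [(_ ^ l * k)%N]mulnC -E => sE.
have -> : (totient n)%:R / n%:R = (1 - P.+1%:R^-1) * ((totient k)%:R / k%:R) :> K.
  have cX : coprime k (P.+1 ^ l) by rewrite coprime_sym coprimeXl.
  rewrite E totient_coprime // totient_pfactor // !natrM.
  case: l l0 {E sE cX} => // l _; rewrite expnS natrM /=.
  have kK : k%:R != 0 :> K by rewrite pnatr_eq0 -lt0n.
  have xK : (P.+1 ^ l)%:R != 0 :> K by rewrite pnatr_eq0 -lt0n expn_gt0.
  have pK : P.+1%:R != 0 :> K by rewrite pnatr_eq0.
  move: (totient k)%:R (k%:R : K) ((P.+1 ^ l)%:R : K) kK xK pK => a b c kK xK pK.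
  have -> : P%:R = P.+1%:R - 1 :> K by rewrite -natr1 addrK.
  move: (P.+1%:R : K) pK => q pK; field.
  by rewrite xK pK kK.
have T0 : 0 <= (totient k)%:R / k%:R :> K by rewrite divr_ge0.
have S0 := sum_inv_divisors_ge0 k.
move: sE S0 T0.
move: (sum_inv_divisors n) (sum_inv_divisors k) ((totient k)%:R / k%:R : K) => sn sk t.
rewrite -natr1; set q : K := P%:R => sE S0 T0 IH.
have q1 : 0 <= 1 - (q + 1)^-1.
  by rewrite subr_ge0 invf_le1 ?lerDr ?ltW //; rewrite /q; lra.
apply: (@le_trans _ _ ((1 - (q + 1)^-1) * t * ((1 + (q + 1)^-1) * sk))); last first.
  by rewrite ler_wpM2l // mulr_ge0.
have -> : (1 - (q + 1)^-1) * t * ((1 + (q + 1)^-1) * sk) =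
   ((1 - (q + 1)^-1) * (1 + (q + 1)^-1)) * (t * sk) by ring.
have -> : 2^-1 * (1 + (q + 1)^-1) =
   ((1 - (q + 1)^-1) * (1 + (q + 1)^-1)) * (2^-1 * (1 + q^-1)).
  have q0 : q != 0 by rewrite gt_eqF.
  have q10 : q + 1 != 0 by rewrite gt_eqF // addr_gt0.
  by field; rewrite q0 q10.
apply: ler_wpM2l => //; apply: mulr_ge0 => //.
by rewrite addr_ge0 // invr_ge0 addr_ge0 // ltW.
Qed.

(** From [totient n * sigma n >= n ^ 2 / 2], [sigma] the sum of divisors. *)
Lemma inv_totient_le n : (0 < n)%N ->
  (totient n)%:R^-1 <= 2 * (\sum_(d <- divisors n) d%:R^-1) / n%:R :> K.
Proof.
move=> n0; have := totient_sum_inv_divisors_ge n0 n0 (fun p _ => dvdn_leq n0).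
rewrite /sum_inv_divisors; set s := \sum_(_ <- _) _ => H.
have nK : 0 < n%:R :> K by rewrite ltr0n.
have tK : 0 < (totient n)%:R :> K by rewrite ltr0n totient_gt0.
have {}H : 2^-1 <= (totient n)%:R / n%:R * s.
  by apply: le_trans H; rewrite ler_peMr // ?invr_ge0 // lerDl invr_ge0 ltW.
rewrite -[leLHS]mul1r ler_pdivrMr //.
have -> : 2 * s / n%:R * (totient n)%:R = 2 * ((totient n)%:R / n%:R * s).
  by field; rewrite gt_eqF.
by lra.
Qed.

Lemma sum_inv_sqr_le n : \sum_(1 <= d < n.+1) (d%:R ^+ 2)^-1 <= 2 :> K.
Proof.
have [->|n0] := posnP n; first by rewrite big_geq.
apply: (@le_trans _ _ (2 - n%:R^-1)); last by rewrite gerBl invr_ge0.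
elim: n n0 => // n IH _; have [->|n0] := posnP n.
  by rewrite big_nat1 expr1n invr1; lra.
rewrite big_nat_recr //=; have := IH n0; rewrite -[n.+1%:R]natr1.
set q : K := n%:R => H.
have q0 : 0 < q by rewrite ltr0n.
apply: (@le_trans _ _ (2 - q^-1 + ((q + 1) ^+ 2)^-1)); first by rewrite lerD2r.
rewrite -subr_ge0.
have -> : 2 - (q + 1)^-1 - (2 - q^-1 + ((q + 1) ^+ 2)^-1) =
  (q * (q + 1) ^+ 2)^-1.
  by field; rewrite !gt_eqF // addr_gt0.
by rewrite invr_ge0 mulr_ge0 ?exprn_ge0 ?addr_ge0 // ltW.
Qed.

Lemma harmonic_le n : (0 < n)%N ->
  \sum_(1 <= d < n.+1) d%:R^-1 <= 1 + ln n%:R :> K.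
Proof.
elim: n => // n IH _; have [->|n0] := posnP n.
  by rewrite big_nat1 invr1 ln1 addr0.
rewrite big_nat_recr //= ; have := IH n0; rewrite -[n.+1%:R]natr1.
set q : K := n%:R => H.
have q0 : 0 < q by rewrite ltr0n.
have q1 : 0 < q + 1 by rewrite addr_gt0.
suff : ln q - ln (q + 1) <= - (q + 1)^-1 by lra.
rewrite -ln_div ?posrE //.
have -> : q / (q + 1) = 1 + (- (q + 1)^-1) by field; rewrite gt_eqF.
by apply: le_ln1Dx; rewrite ltrN2 invf_lt1 // ltrDr.
Qed.

Lemma sum_inv_totient_le n : (0 < n)%N ->
  \sum_(1 <= d < n.+1) (totient d)%:R^-1 <= 4 * (1 + ln n%:R) :> K.
Proof.
move=> n0.
apply: (@le_trans _ _ (\sum_(1 <= m < n.+1) \sum_(d <- divisors m)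
    2 * ((d%:R * (d * (m %/ d))%N%:R)^-1))).
  rewrite [leLHS]big_nat_cond [leRHS]big_nat_cond; apply: ler_sum => m.
  rewrite andbT => /andP[m0 _]; apply: (le_trans (inv_totient_le m0)).
  rewrite mulr_sumr mulr_suml !big_seq; apply: ler_sum => d.
  rewrite -dvdn_divisors // => dm.
  by rewrite mulnC divnK // invfM mulrA.
rewrite (sum_range_dvd _ (fun d k => 2 * (d%:R * (d * k)%:R)^-1)).
apply: (@le_trans _ _ (\sum_(1 <= d < n.+1) \sum_(1 <= k < n.+1)
    2 * ((d%:R ^+ 2)^-1 * k%:R^-1))).
  apply: ler_sum => d _; rewrite [leLHS]big_mkcond; apply: ler_sum => k _.
  case: ifP => _; first by rewrite natrM mulrA -expr2 invfM.
  by rewrite !mulr_ge0 ?invr_ge0 ?exprn_ge0.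
under eq_bigr => d _ do rewrite -mulr_sumr -mulr_sumr mulrCA.
rewrite -mulr_suml.
have -> : 4 * (1 + ln n%:R) = 2 * (2 * (1 + ln n%:R)) :> K by ring.
apply: ler_pM; rewrite ?sum_inv_sqr_le //.
- by apply: sumr_ge0 => d _; rewrite invr_ge0 exprn_ge0.
- by rewrite mulr_ge0 // sumr_ge0 // => d _; rewrite invr_ge0.
- by rewrite ler_pM2l // harmonic_le.
Qed.

Lemma totient_dvd_le d n : (0 < n)%N -> (d %| n)%N ->
  (totient d <= totient n)%N.
Proof.
move=> n0 dn; have d0 := dvdn_gt0 n0 dn; have q0 : (0 < n %/ d)%N by rewrite divn_gt0 // dvdn_leq.
rewrite -(divnK dn) mulnC; apply: leq_trans (totient_supermul d0 q0).
by rewrite leq_pmulr // totient_gt0.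
Qed.

(** Ratio of the number of divisors to the totient. *)
Definition tau_phi n : K := (ntau n)%:R / (totient n)%:R.

Lemma tau_phi_ge0 n : 0 <= tau_phi n.
Proof. by rewrite divr_ge0. Qed.

Lemma tau_phiE n : tau_phi n = \sum_(d <- divisors n) (totient n)%:R^-1.
Proof.
by rewrite /tau_phi /ntau big_const_seq count_predT iter_addr_0 mulr_natl.
Qed.

Lemma tau_phi_le B k : (0 < k < B)%N ->
  tau_phi k <= \sum_(1 <= d < B) (totient d)%:R^-1.
Proof.
case/andP=> k0 kB; rewrite tau_phiE.
apply: (@le_trans _ _ (\sum_(d <- divisors k) (totient d)%:R^-1)).
  rewrite !big_seq; apply: ler_sum => d; rewrite -dvdn_divisors // => dk.
  rewrite lef_pV2 ?posrE ?ltr0n ?totient_gt0 ?(dvdn_gt0 k0 dk) //.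
  by rewrite ler_nat totient_dvd_le.
rewrite (sum_divisors_range _ k0 kB); apply: ler_sum_subset => // d _ _.
Qed.

(** Uses [totient d * totient (k / d) <= totient k] for each divisor [d]. *)
Lemma sum_tau_phi_le B :
  \sum_(1 <= k < B) tau_phi k <= (\sum_(1 <= d < B) (totient d)%:R^-1) ^+ 2.
Proof.
pose F d k : K := (totient d)%:R^-1 * (totient k)%:R^-1.
apply: (@le_trans _ _ (\sum_(1 <= k < B) \sum_(d <- divisors k) F d (k %/ d)%N)).
  rewrite [leLHS]big_nat_cond [leRHS]big_nat_cond; apply: ler_sum => k.
  rewrite andbT tau_phiE => /andP[k0 _].
  rewrite !big_seq; apply: ler_sum => d; rewrite -dvdn_divisors // => dk.
  have d0 := dvdn_gt0 k0 dk; have q0 : (0 < k %/ d)%N by rewrite divn_gt0 // dvdn_leq.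
  rewrite /F -invfM lef_pV2 ?posrE ?mulr_gt0 ?ltr0n ?totient_gt0 //.
  have := totient_supermul d0 q0; rewrite [(d * _)%N]mulnC divnK // => H.
  by rewrite -natrM ler_nat.
rewrite sum_range_dvd expr2 mulr_suml; apply: ler_sum => d _.
rewrite mulr_sumr; apply: ler_sum_subset => // k _ _.
by rewrite /F mulr_ge0 ?invr_ge0.
Qed.

(** For each of the values [g | a] of the gcd, the quotients [m / g] are
    distinct positive integers below [B]. *)
Lemma sum_div_gcd_le a B w : (0 < a)%N -> (forall k, 0 <= w k) ->
  \sum_(1 <= m < B) w (m %/ gcdn m a)%N <= (ntau a)%:R * \sum_(1 <= k < B) w k.
Proof.
move=> a0 w0.
pose F d k : K := (d %| a)%N%:R * w k.
apply: (@le_trans _ _ (\sum_(1 <= m < B) \sum_(d <- divisors m) F d (m %/ d)%N)).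
  rewrite [leLHS]big_nat_cond [leRHS]big_nat_cond; apply: ler_sum => m.
  rewrite andbT => /andP[m0 _].
  rewrite (bigD1_seq (gcdn m a)) ?divisors_uniq //=; last first.
    by rewrite -dvdn_divisors // dvdn_gcdl.
  rewrite {1}/F dvdn_gcdr mul1r lerDl; apply: sumr_ge0 => d _.
  by rewrite mulr_ge0.
rewrite sum_range_dvd.
apply: (@le_trans _ _ (\sum_(1 <= d < B) (d %| a)%N%:R * \sum_(1 <= k < B) w k)).
  apply: ler_sum => d _; rewrite mulr_sumr; apply: ler_sum_subset => // k _ _.
  by rewrite mulr_ge0.
rewrite -mulr_suml; apply: ler_wpM2r; first exact: sumr_ge0.
rewrite -natr_sum ler_nat.
have -> : (\sum_(1 <= d < B) (d %| a) = size [seq d <- index_iota 1 B | d %| a])%N.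
  rewrite -sum1_size big_filter [RHS]big_mkcond; apply: eq_bigr => d _.
  by case: (d %| a)%N.
apply: uniq_leq_size => [|d]; first by rewrite filter_uniq ?iota_uniq.
by rewrite mem_filter -dvdn_divisors // => /andP[].
Qed.

End TotientSums.

(** * Sums of a monotone function over an arithmetic progression *)

Section MonotoneSums.
Variable K : realType.
Implicit Types (v : K -> K) (s t x y A B : K) (n l c : nat).
Local Notation mu := (@lebesgue_measure K).
Local Notation U v x := (Rintegral mu `[0, x] v).

(** Restriction to the half-line of a continuous function on the line. *)
Definition continuous_nneg v : Prop :=
  exists2 w : K -> K, continuous w & forall t, 0 <= t -> v t = w t.

Lemma smooth_continuous_nneg v : smooth_nneg v -> continuous_nneg v.
Proof.
case=> w [wd vw]; exists w => // z.
apply: (@differentiable_continuous K K^o K^o).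
exact/derivable1_diffP/(wd 0%N).
Qed.

Lemma continuous_nneg_integrable v t : continuous_nneg v ->
  mu.-integrable `[0, t]%classic (EFin \o v).
Proof.
case=> w wc vw.
have wi : mu.-integrable `[0, t]%classic (EFin \o w).
  apply: continuous_compact_integrable; first exact: segment_compact.
  exact: continuous_subspaceT.
apply: eq_integrable wi => // z.
by rewrite inE /= in_itv /= => /andP[z0 _]; rewrite vw.
Qed.

Lemma integral_sub_bounds v s t A B : continuous_nneg v -> 0 <= s -> s <= t ->
  (forall z, s <= z <= t -> A <= v z <= B) ->
  A * (t - s) <= U v t - U v s <= B * (t - s).
Proof.
move=> sv s0 st vAB; have it := continuous_nneg_integrable t sv.
have lenE : fine (mu `]s, t]%classic) = t - s.
  rewrite lebesgue_measure_itv /= lte_fin; case: ltP => // ts.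
  by apply/esym/eqP; rewrite subr_eq0 eq_le st ts.
have ic (c : K) : mu.-integrable `]s, t]%classic (EFin \o (fun=> c)).
  apply: (@integrableS _ _ _ mu `[s, t]%classic) => //.
    exact: subset_itv_oc_cc.
  apply: continuous_compact_integrable; first exact: segment_compact.
  by apply: continuous_subspaceT => z; exact: cst_continuous.
have iv : mu.-integrable `]s, t]%classic (EFin \o v).
  apply: integrableS it => //; apply: subset_itv; rewrite bnd_simp //.
rewrite Rintegral_itvB ?bnd_simp //.
apply/andP; split.
  rewrite -lenE -Rintegral_cst //; apply: le_Rintegral => //=; try exact: ic; move=> z /=.
  rewrite in_itv /= => /andP[sz zt].
by have /andP[] : A <= v z <= B by apply: vAB; rewrite (ltW sz) zt.
rewrite -lenE -Rintegral_cst //; apply: le_Rintegral => //=; try exact: ic; move=> z /=.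
rewrite in_itv /= => /andP[sz zt].
by have /andP[] : A <= v z <= B by apply: vAB; rewrite (ltW sz) zt.
Qed.

Lemma normr_monotonic_nneg v t x : monotonic_nneg v -> 0 <= t -> t <= x ->
  `|v t| <= `|v 0| + `|v x|.
Proof.
move=> mv t0 tx.
have := ler_norm (v x); have := ler_norm (- v x).
have := ler_norm (v 0); have := ler_norm (- v 0); rewrite !normrN.
have := normr_ge0 (v x); have := normr_ge0 (v 0) => b1 b2 b3 b4 b5 b6.
rewrite ler_norml; case: mv => mv; have := mv _ _ (lexx 0) t0;
  have := mv _ _ t0 tx => c1 c2; apply/andP; split; lra.
Qed.

Lemma integral0 v : U v 0 = 0.
Proof. by rewrite set_itv1 Rintegral_set1. Qed.

(** Sum of [v n] over the positive integers [n <= y] congruent to [c] mod [l]. *)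
Definition ap_count_sum v l c y : K :=
  \sum_(1 <= n < (Num.truncn y).+1 | n == c %[mod l]) v n%:R.

(** Among [l] consecutive integers exactly one lies in a given class mod [l]. *)
Lemma sum_one_residue (F : nat -> K) T l c : (0 < l)%N ->
  exists2 n : nat, (T < n <= T + l)%N &
    \sum_(T.+1 <= n < (T + l).+1 | n == c %[mod l]) F n = F n.
Proof.
move=> l0.
have [n /andP[Tn nT] nc] : exists2 n : nat, (T < n <= T + l)%N & n == c %[mod l].
  exists (T + ((c + l * T.+1 - T.+1) %% l).+1)%N.
    by have := ltn_pmod (c + l * T.+1 - T.+1) l0; lia.
  rewrite addnS -addSn -modnDmr modn_mod modnDmr subnKC; last by nia.
  by rewrite addnC [(l * _)%N]mulnC modnMDl.
exists n; first by rewrite Tn nT.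
rewrite -big_filter (bigD1_seq n) ?filter_uniq ?iota_uniq //=; last first.
  by rewrite mem_filter nc mem_index_iota Tn.
rewrite big1_seq ?addr0 // => k /andP[kn].
rewrite mem_filter mem_index_iota => /and3P[kc Tk kT]; case/negP: kn.
move: kc; rewrite -(eqP nc).
wlog kn : k n {nc} Tn nT Tk kT / (k <= n)%N.
  move=> H; case/orP: (leq_total k n) => kn; first exact: H.
  by move=> kc; rewrite eq_sym; apply: H => //; rewrite eq_sym.
rewrite eq_sym eqn_mod_dvd // => /dvdnP[q qE].
have : (q = 0)%N by nia.
by move=> q0; apply/eqP; nia.
Qed.

Lemma truncn_add y l : 0 <= y -> Num.truncn (y + l%:R) = (Num.truncn y + l)%N.
Proof.
move=> y0; apply/eqP; rewrite truncn_eq; last by rewrite addr_ge0.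
case/andP: (truncn_itv y0) => a b.
by rewrite natrD lerD2r a -addSn natrD ltrD2r b.
Qed.

(** Moving the endpoint by [l] adds exactly one term to the sum and an integral
    over an interval of length [l] to the main term, so that the error changes
    by at most the variation of [v]. *)
Lemma ap_count_sum_nondecreasing v l c y : continuous_nneg v -> (0 < l)%N ->
  (forall s t, 0 <= s -> s <= t -> v s <= v t) -> 0 <= y ->
  `|ap_count_sum v l c y - U v y / l%:R| <= 5 * (`|v 0| + `|v y|).
Proof.
move=> sv l0 mv y0.
have lK : 0 < l%:R :> K by rewrite ltr0n.
pose D y := ap_count_sum v l c y - U v y / l%:R.
(* Below [l] the sum has at most one term. *)
have D0 z : 0 <= z -> z < l%:R -> `|D z| <= 2 * (`|v 0| + `|v z|).
  move=> z0 zl.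
  have b t : 0 <= t <= z -> `|v t| <= `|v 0| + `|v z|.
    case/andP=> t0 tz; have := mv _ _ (lexx 0) t0; have := mv _ _ t0 tz.
    rewrite ler_norml; have := ler_norm (v z); have := ler_norm (- v 0).
    rewrite normrN; have := normr_ge0 (v z); have := normr_ge0 (v 0).
    by move: (`|v 0|) (`|v z|) => *; apply/andP; split; lra.
  have -> : 2 * (`|v 0| + `|v z|) = (`|v 0| + `|v z|) + (`|v 0| + `|v z|) by ring.
  apply: (le_trans (ler_normB _ _)); apply: lerD.
    have Tl : (Num.truncn z < l)%N by rewrite truncn_lt_nat.
    have [n /andP[n0 nl] E] := sum_one_residue
      (fun n => if (n <= Num.truncn z)%N then v n%:R else 0) 0 c l0.
    rewrite /ap_count_sum.
    have -> : \sum_(1 <= n < (Num.truncn z).+1 | n == c %[mod l]) v n%:R =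
        if (n <= Num.truncn z)%N then v n%:R else 0.
      rewrite -E add0n [RHS](@big_cat_nat _ _ _ (Num.truncn z).+1) //=; last by lia.
      rewrite [X in _ + X]big1_seq ?addr0.
        rewrite big_nat_cond [RHS]big_nat_cond; apply: eq_bigr => k /andP[/andP[_ kT] _].
        by rewrite -ltnS kT.
      by move=> k /andP[_]; rewrite mem_index_iota => /andP[kT _]; rewrite leqNgt kT.
    case: ifP => [nz|_]; last by rewrite normr0 addr_ge0.
    by apply: b; rewrite ler0n -truncn_ge_nat.
  have : - (`|v 0| + `|v z|) * (z - 0) <= U v z - U v 0 <= (`|v 0| + `|v z|) * (z - 0).
    apply: integral_sub_bounds => // t /b; rewrite ler_norml => //.
  rewrite integral0 !subr0 mulNr -ler_norml => H.
  rewrite normrM normfV (gtr0_norm lK) ler_pdivrMr //.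
  apply: (le_trans H); apply: ler_wpM2l; first exact: addr_ge0.
  exact: ltW.
have DS z : 0 <= z -> `|D (z + l%:R) - D z| <= v (z + l%:R) - v z.
  move=> z0; rewrite /D /ap_count_sum truncn_add //.
  rewrite (@big_cat_nat _ _ _ (Num.truncn z).+1) //=; last by rewrite ltnS leq_addr.
  have [n /andP[Tn nT] ->] := sum_one_residue (fun n => v n%:R) (Num.truncn z) c l0.
  have zl : z <= z + l%:R by rewrite lerDl ltW.
  have : v z * (z + l%:R - z) <= U v (z + l%:R) - U v z <= v (z + l%:R) * (z + l%:R - z).
    apply: integral_sub_bounds => // t /andP[zt tl].
    by rewrite !mv // (le_trans z0).
  rewrite [z + _]addrC addrK addrC.
  have nz : z <= n%:R by rewrite ltW // -truncn_lt_nat.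
  have nl : n%:R <= z + l%:R.
    by rewrite -truncn_ge_nat ?truncn_add ?addr_ge0.
  have v1 := mv _ _ z0 nz; have v2 := mv _ _ (le_trans z0 nz) nl.
  set S := \sum_(_ <= _ < _ | _) _.
  move: v1 v2; move: (v n%:R) (v z) (v (z + l%:R)) (U v z) (U v (z + l%:R)) => vn vz vl Uz Ul v1 v2.
  rewrite -(ler_pdivlMr _ _ lK) -(ler_pdivrMr _ _ lK) => /andP[H1 H2].
  have E : S + vn - Ul / l%:R - (S - Uz / l%:R) = vn - (Ul - Uz) / l%:R by field; rewrite gt_eqF.
  rewrite E ler_norml; apply/andP; split; lra.
(* The variations of [v] over the successive steps telescope. *)
have Dn k z : 0 <= z -> z < l%:R ->
    `|D (z + l%:R * k%:R)| <= `|D z| + (v (z + l%:R * k%:R) - v z).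
  move=> z0 zl; elim: k => [|k IH]; first by rewrite mulr0 addr0 subrr addr0.
  have -> : z + l%:R * k.+1%:R = (z + l%:R * k%:R) + l%:R :> K.
    by rewrite -natr1 mulrDr mulr1 addrA.
  have zk0 : 0 <= z + l%:R * k%:R by rewrite addr_ge0 // mulr_ge0.
  have := DS _ zk0; move: IH; set a := z + l%:R * k%:R.
  move=> H1 H2; rewrite -[D (a + _)](subrK (D a)).
  by apply: (le_trans (ler_normD _ _)); lra.
(* The endpoint [y] is [k] steps of length [l] after [z = y - k l < l]. *)
pose k := (Num.truncn (y / l%:R)).
have yl0 : 0 <= y / l%:R by rewrite divr_ge0 // ltW.
case/andP: (truncn_itv yl0); rewrite -/k ler_pdivlMr // ltr_pdivrMr // => k1 k2.
pose z := y - l%:R * k%:R.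
have z0 : 0 <= z by rewrite subr_ge0 mulrC.
have zl : z < l%:R by move: k2; rewrite ltrBlDl -natr1 mulrDl mul1r [k%:R * _]mulrC.
have zy : z <= y by rewrite gerBl mulr_ge0 // ltW.
have := Dn k z z0 zl; rewrite subrK => H.
rewrite -/(D y); apply: (le_trans H).
have H0 := D0 _ z0 zl.
have := mv _ _ (lexx 0) z0; have := mv _ _ z0 zy.
have := ler_norm (v y); have := ler_norm (- v 0); rewrite normrN => a1 a2 a3 a4.
have : `|v z| <= `|v 0| + `|v y|.
  have := normr_ge0 (v y); have := normr_ge0 (v 0) => b1 b2.
  by rewrite ler_norml; apply/andP; split; lra.
have := normr_ge0 (v y); have := normr_ge0 (v 0) => b1 b2.
lra.
Qed.

Lemma ap_count_sum_monotonic v l c y x : smooth_nneg v -> monotonic_nneg v ->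
  (0 < l)%N -> 0 <= y -> y <= x ->
  `|ap_count_sum v l c y - U v y / l%:R| <= 10 * (`|v 0| + `|v x|).
Proof.
move=> /smooth_continuous_nneg cv mv l0 y0 yx.
have vyx := normr_monotonic_nneg mv y0 yx.
apply: (@le_trans _ _ (5 * (`|v 0| + `|v y|))); last first.
  by have := normr_ge0 (v x); have := normr_ge0 (v 0); lra.
case: mv => mv; first exact: ap_count_sum_nondecreasing.
have cN : continuous_nneg (fun t => - v t).
  case: cv => w wc vw; exists (fun t => - w t) => [z|t t0]; last by rewrite vw.
  by apply: continuousN; exact: wc.
have mN s t : 0 <= s -> s <= t -> - v s <= - v t.
  by move=> s0 st; rewrite lerN2 mv.
have := @ap_count_sum_nondecreasing (fun t => - v t) l c y cN l0 mN y0.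
rewrite !normrN.
have -> : U (fun t => - v t) y = - U v y.
  rewrite -mulN1r -RintegralZl //; last exact: continuous_nneg_integrable.
  by apply: eq_Rintegral => t _; rewrite mulN1r.
by rewrite /ap_count_sum sumrN mulNr -opprD normrN.
Qed.

Lemma normr_integral_le v y x : smooth_nneg v -> monotonic_nneg v ->
  0 <= y -> y <= x -> `|U v y| <= y * (`|v 0| + `|v x|).
Proof.
move=> /smooth_continuous_nneg cv mv y0 yx; rewrite mulrC.
have : - (`|v 0| + `|v x|) * (y - 0) <= U v y - U v 0 <= (`|v 0| + `|v x|) * (y - 0).
  apply: integral_sub_bounds => // t /andP[t0 ty].
  by rewrite -ler_norml normr_monotonic_nneg // (le_trans ty).
by rewrite integral0 !subr0 mulNr -ler_norml.
Qed.

End MonotoneSums.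

(** * The model [F_R] in arithmetic progressions *)

Lemma eqn_mod_lcm d m n c :
  (n == c %[mod lcmn d m]) = (n == c %[mod d]) && (n == c %[mod m]).
Proof.
wlog cn : n c / (c <= n)%N.
  move=> H; case/orP: (leq_total c n) => cn; first exact: H.
  by rewrite eq_sym H // [in LHS]eq_sym [X in _ && X]eq_sym.
by rewrite !eqn_mod_dvd // dvdn_lcm.
Qed.

(** Two congruences, one of them with residue 0, amount to a single one modulo
    the lcm as soon as they are compatible. *)
Lemma chinese_dvd d m b : (0 < d)%N -> (gcdn d m %| b)%N ->
  exists c, forall n,
    (n == b %[mod m]) && (d %| n)%N = (n == c %[mod lcmn d m]).
Proof.
move=> d0 gb.
have [n0 n0b dn0] : exists2 n0, n0 == b %[mod m] & (d %| n0)%N.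
  case/dvdnP: gb => q ->.
  case: (egcdnP m d0) => ku kw E _.
  exists (q * (ku * d))%N; last by rewrite mulnA dvdn_mull.
  by rewrite E mulnDr mulnA modnMDl.
exists n0 => n; rewrite eqn_mod_lcm andbC (eqP n0b); congr (_ && _).
by rewrite /dvdn (eqP dn0).
Qed.

(** The Ramanujan sum [c_r(n)] divided by [totient r]. *)
Definition ramanujan (K : realFieldType) (r n : nat) : K :=
  (moebius (r %/ gcdn r n))%:~R / (totient (r %/ gcdn r n))%:R.

Section Model.
Variable K : realType.
Implicit Types (v : K -> K) (x y R : K) (n m b d r : nat).
Local Notation mu := (@lebesgue_measure K).
Local Notation U v x := (Rintegral mu `[0, x] v).
Local Notation "''mu' n" := ((moebius n)%:~R : K) (at level 8, n at level 2).

Lemma ramanujanE r n : (0 < r)%N ->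
  ramanujan K r n = (totient r)%:R^-1 *
    \sum_(d <- divisors r) (d %| n)%N%:R * (d%:R * (moebius (r %/ d))%:~R).
Proof.
move=> r0; have tK : (totient r)%:R != 0 :> K by rewrite pnatr_eq0 -lt0n totient_gt0.
apply: (mulfI tK); rewrite [RHS]mulrA divff // mul1r -ramanujan_sum // big_mkcond.
by apply: eq_bigr => d _; case: (d %| n)%N; rewrite ?mul1r ?mul0r.
Qed.

Lemma normr_moebius_le1 n : `|(moebius n)%:~R| <= 1 :> K.
Proof.
rewrite /moebius; case: ifP => _; last by rewrite normr0.
by rewrite rmorphXn rmorphN1 /= normrX normrN1 expr1n.
Qed.

(** The main term is [U(y) / lcm (d, m)] if [gcd (d, m)] divides [b], and
    otherwise 0, the sum being empty. *)
Lemma ap_dvd_sum v x y m b d : smooth_nneg v -> monotonic_nneg v ->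
  0 <= y -> y <= x -> (0 < m)%N -> (0 < d)%N ->
  `|\sum_(1 <= n < (Num.truncn y).+1 | (n == b %[mod m]) && (d %| n)%N) v n%:R
    - (gcdn d m %| b)%N%:R * (U v y * ((gcdn d m)%:R / (d%:R * m%:R)))|
  <= 10 * (`|v 0| + `|v x|).
Proof.
move=> sv mv y0 yx m0 d0; case: (boolP (gcdn d m %| b)%N) => gb; last first.
  rewrite mul0r subr0 big1; first by rewrite normr0 !mulr_ge0 // addr_ge0.
  move=> n /andP[nb dn]; case/negP: gb.
  rewrite /dvdn -(modn_dvdm b (dvdn_gcdr d m)) -(eqP nb).
  by rewrite modn_dvdm ?dvdn_gcdr // -/(dvdn _ _) (dvdn_trans (dvdn_gcdl _ _) dn).
rewrite mul1r; have [c cP] := chinese_dvd d0 gb.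
under eq_bigl => n do rewrite cP.
have l0 : (0 < lcmn d m)%N by rewrite lcmn_gt0 d0.
have := ap_count_sum_monotonic c sv mv l0 y0 yx.
suff -> : (gcdn d m)%:R / (d%:R * m%:R) = (lcmn d m)%:R^-1 :> K by [].
rewrite -natrM -muln_lcm_gcd natrM.
have gK : (gcdn d m)%:R != 0 :> K by rewrite pnatr_eq0 -lt0n gcdn_gt0 d0.
by rewrite invfM mulrCA divff // mulr1.
Qed.

(** The main term is supported on the divisors [r] of [m], by
    [moebius_gcd_sum]. *)
Lemma ap_ramanujan_sum v x y m b r R : smooth_nneg v -> monotonic_nneg v ->
  0 <= y -> y <= x -> (0 < m)%N -> 1 <= R -> (0 < r < (Num.truncn R).+1)%N ->
  `|\sum_(1 <= n < (Num.truncn y).+1 | n == b %[mod m]) v n%:R * ramanujan K r n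
    - (r %| m)%N%:R * (ramanujan K r b * (U v y / m%:R))|
  <= 10 * (`|v 0| + `|v x|) * (r%:R / (totient r)%:R * (1 + ln R)).
Proof.
move=> sv mv y0 yx m0 R1 /andP[r0 rR].
set E := 10 * _; set T := Num.truncn y.
have tK : 0 < (totient r)%:R :> K by rewrite ltr0n totient_gt0.
pose A d := \sum_(1 <= n < T.+1 | (n == b %[mod m]) && (d %| n)%N) v n%:R.
pose M d : K := (gcdn d m %| b)%N%:R * (U v y * ((gcdn d m)%:R / (d%:R * m%:R))).
have -> : \sum_(1 <= n < T.+1 | n == b %[mod m]) v n%:R * ramanujan K r n =
    (totient r)%:R^-1 * \sum_(d <- divisors r) d%:R * 'mu (r %/ d) * A d.
  under eq_bigr => n _ do rewrite ramanujanE // mulrCA mulr_sumr.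
  rewrite -mulr_sumr exchange_big /=; congr (_ * _); apply: eq_bigr => d _.
  rewrite /A mulr_sumr [RHS]big_mkcondr; apply: eq_bigr => n _.
  by case: (d %| n)%N; rewrite ?mul1r ?mul0r ?mulr0 // mulrC.
have -> : (r %| m)%N%:R * (ramanujan K r b * (U v y / m%:R)) =
    (totient r)%:R^-1 * \sum_(d <- divisors r) d%:R * 'mu (r %/ d) * M d.
  have -> : \sum_(d <- divisors r) d%:R * 'mu (r %/ d) * M d = U v y / m%:R *
     \sum_(d <- divisors r)
       (gcdn d m %| b)%N%:R * (gcdn d m)%:R * 'mu (r %/ d).
    rewrite mulr_sumr !big_seq; apply: eq_bigr => d.
    rewrite -dvdn_divisors // => dr; rewrite /M.
    have dK : d%:R != 0 :> K by rewrite pnatr_eq0 -lt0n (dvdn_gt0 r0).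
    have mK : m%:R != 0 :> K by rewrite pnatr_eq0 -lt0n.
    move: ('mu (r %/ d)) ((gcdn d m %| b)%N%:R : K) ((gcdn d m)%:R : K) (U v y) => a1 a2 a3 a4.
    by field; rewrite dK mK.
  rewrite (moebius_gcd_sum (fun d => (d %| b)%N%:R * d%:R)) // ramanujanE //.
  rewrite [X in _ = _ * (_ * (_ * X))](_ : _ =
    \sum_(d <- divisors r) (d %| b)%N%:R * (d%:R * 'mu (r %/ d))); last first.
    by apply: eq_bigr => d _; rewrite mulrA.
  move: (\sum_(_ <- _) _) => S; ring.
rewrite -mulrBr -sumrB normrM normfV (gtr0_norm tK).
apply: (@le_trans _ _ ((totient r)%:R^-1 * \sum_(d <- divisors r) d%:R * E)).
  apply: ler_wpM2l; first by rewrite invr_ge0.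
  apply: (le_trans (ler_norm_sum _ _ _)); rewrite !big_seq; apply: ler_sum => d.
  rewrite -dvdn_divisors // => dr; rewrite -mulrBr !normrM normr_nat -mulrA.
  apply: ler_wpM2l => //; rewrite -[E]mul1r.
  apply: ler_pM => //; first exact: normr_moebius_le1.
  by apply: ap_dvd_sum => //; exact: dvdn_gt0 dr.
have E0 : 0 <= E by rewrite mulr_ge0 // addr_ge0.
rewrite -mulr_suml.
have -> : E * (r%:R / (totient r)%:R * (1 + ln R)) =
   (totient r)%:R^-1 * (r%:R * (1 + ln R) * E).
  by move: (totient r)%:R^-1 => q; ring.
apply: ler_wpM2l; first by rewrite invr_ge0.
apply: ler_wpM2r => //.
rewrite -sum_divisors_flip //=.
have R0 := lt_le_trans ltr01 R1.
have tR : (0 < Num.truncn R)%N by rewrite truncn_gt0.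
apply: (@le_trans _ _ (r%:R * \sum_(1 <= d < (Num.truncn R).+1) d%:R^-1)).
  rewrite (sum_divisors_range _ r0 rR) mulr_sumr big_mkcond.
  apply: ler_sum => d _; case: ifP => [dr|_]; last by rewrite mulr_ge0 ?invr_ge0.
  have dK : 0 < d%:R :> K by rewrite ltr0n (dvdn_gt0 r0).
  by rewrite ler_pdivlMr // -natrM divnK.
apply: ler_wpM2l => //; apply: (le_trans (harmonic_le K tR)).
by rewrite lerD2l ler_ln ?posrE ?ltr0n // truncn_le ltW.
Qed.

Lemma FR_ap_sum J (h : nat -> nat -> K) (u : nat -> K -> K) x y R m b :
  (forall j, (j < J)%N -> smooth_nneg (u j) /\ monotonic_nneg (u j)) ->
  0 <= y -> y <= x -> 1 <= R -> (0 < m < (Num.truncn R).+1)%N ->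
  `|\sum_(1 <= n < (Num.truncn y).+1 | n == b %[mod m]) FR J h u R n
    - \sum_(0 <= j < J) U (u j) y *
        (m%:R^-1 * \sum_(r <- divisors m) hmu h j r * ramanujan K r b)|
  <= \sum_(0 <= j < J) 10 * (`|u j 0| + `|u j x|) *
       ((\sum_(1 <= r < (Num.truncn R).+1) `|hmu h j r| * r%:R / (totient r)%:R)
        * (1 + ln R)).
Proof.
move=> uP y0 yx R1 /andP[m0 mR]; set T := Num.truncn y; set B := (Num.truncn R).+1.
have -> : \sum_(1 <= n < T.+1 | n == b %[mod m]) FR J h u R n =
    \sum_(0 <= j < J) \sum_(1 <= r < B) hmu h j r *
      \sum_(1 <= n < T.+1 | n == b %[mod m]) u j n%:R * ramanujan K r n.
  rewrite /FR exchange_big /=; apply: eq_bigr => j _.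
  under [RHS]eq_bigr => r _ do rewrite mulr_sumr.
  rewrite [RHS]exchange_big /=; apply: eq_bigr => n _.
  rewrite mulr_sumr; apply: eq_bigr => r _.
  by rewrite /ramanujan -!mulrA [in RHS]mulrCA; congr (_ * (_ * _)); rewrite mulrC.
rewrite -sumrB; apply: (le_trans (ler_norm_sum _ _ _)).
rewrite [leLHS]big_nat_cond [leRHS]big_nat_cond; apply: ler_sum => j.
rewrite andbT => /andP[_ jJ]; have [sj mj] := uP _ jJ.
rewrite (sum_divisors_range _ m0 mR).
have -> : U (u j) y * (m%:R^-1 *
    \sum_(1 <= r < B | (r %| m)%N) hmu h j r * ramanujan K r b) =
    \sum_(1 <= r < B) hmu h j r *
       ((r %| m)%N%:R * (ramanujan K r b * (U (u j) y / m%:R))).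
  rewrite mulrA mulr_sumr big_mkcond; apply: eq_bigr => r _.
  case: (r %| m)%N; rewrite ?mul0r ?mulr0 // mul1r.
  by rewrite mulrCA [_ * ramanujan _ _ _]mulrC.
rewrite -sumrB; apply: (le_trans (ler_norm_sum _ _ _)).
rewrite mulr_suml mulr_sumr [leLHS]big_nat_cond [leRHS]big_nat_cond.
apply: ler_sum => r; rewrite andbT => rB.
rewrite -mulrBr normrM.
have H := ap_ramanujan_sum b sj mj y0 yx m0 R1 rB.
apply: (le_trans (ler_wpM2l (normr_ge0 (hmu h j r)) H)).
rewrite le_eqVlt; apply/orP; left; apply/eqP.
by move: (totient r)%:R^-1 => q; ring.
Qed.

End Model.

(** * The sequence in arithmetic progressions *)

Section Sequence.
Variable K : realType.
Implicit Types (f w : nat -> K) (h : nat -> nat -> K) (u : nat -> K -> K).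
Implicit Types (Q L : K -> K) (x y R E : K) (J j n m b d e r B : nat).
Local Notation mu := (@lebesgue_measure K).
Local Notation "''mu' n" := ((moebius n)%:~R : K) (at level 8, n at level 2).

Lemma dvdn_gcd_cond m b n : (0 < m)%N ->
  (gcdn n m == gcdn b m) =
  (gcdn b m %| n)%N && coprime (m %/ gcdn b m) (n %/ gcdn b m).
Proof.
move=> m0; set g := gcdn b m; have g0 : (0 < g)%N by rewrite gcdn_gt0 m0 orbT.
have gm : (g %| m)%N := dvdn_gcdr b m.
case: (boolP (g %| n)%N) => gn /=; last first.
  by apply: contraNF gn => /eqP <-; exact: dvdn_gcdl.
have -> : gcdn n m = (gcdn (m %/ g) (n %/ g) * g)%N.
  by rewrite muln_gcdl !divnK // gcdnC.
by rewrite /coprime -[X in _ == X]mul1n eqn_pmul2r.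
Qed.

Lemma sum_gcd_eq f m b B : (0 < m)%N ->
  \sum_(1 <= n < B | gcdn n m == gcdn b m) f n =
  \sum_(d <- divisors (m %/ gcdn b m)) 'mu d *
     \sum_(1 <= n < B | (d * gcdn b m %| n)%N) f n.
Proof.
move=> m0; set g := gcdn b m.
have g0 : (0 < g)%N by rewrite gcdn_gt0 m0 orbT.
have k0 : (0 < m %/ g)%N by rewrite divn_gt0 // dvdn_leq // dvdn_gcdr.
transitivity (\sum_(1 <= n < B) \sum_(d <- divisors (m %/ g))
    if (d * g %| n)%N then 'mu d * f n else 0); last first.
  rewrite exchange_big /=; apply: eq_bigr => d _.
  by rewrite mulr_sumr [RHS]big_mkcond.
rewrite big_mkcond; apply: eq_bigr => n _; rewrite dvdn_gcd_cond // -/g.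
case: (boolP (g %| n)%N) => gn /=; last first.
  rewrite big1 // => d _; case: ifP => // dgn; case/negP: gn.
  exact: dvdn_trans (dvdn_mull d (dvdnn g)) dgn.
transitivity (f n * \sum_(d <- divisors (m %/ g) | (d %| n %/ g)%N) 'mu d).
  by rewrite sum_moebius_coprime //; case: ifP => _; rewrite ?mulr1 ?mulr0.
rewrite mulr_sumr big_mkcond; apply: eq_bigr => d _.
by rewrite dvdn_divRL // mulrC; case: ifP => //; rewrite mulr0.
Qed.

(** The two main terms agree: the average of [h j] over the classes with
    [gcd (n, m) = gcd (b, m)] is the average of the model. *)
Lemma main_term_eq h j m b : (0 < m)%N ->
  let g := gcdn b m in
  (totient (m %/ g))%:R^-1 *
    \sum_(d <- divisors (m %/ g)) 'mu d * (h j (d * g)%N / (d * g)%:R) =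
  m%:R^-1 * \sum_(r <- divisors m) hmu h j r * ramanujan K r b.
Proof.
move=> m0 g; have g0 : (0 < g)%N by rewrite gcdn_gt0 m0 orbT.
have gm : (g %| m)%N := dvdn_gcdr b m.
set k := (m %/ g)%N; have kg : m = (k * g)%N by rewrite divnK.
have k0 : (0 < k)%N by rewrite divn_gt0 // dvdn_leq.
have gK : g%:R != 0 :> K by rewrite pnatr_eq0 -lt0n.
have kK : k%:R != 0 :> K by rewrite pnatr_eq0 -lt0n.
have tK : (totient k)%:R != 0 :> K by rewrite pnatr_eq0 -lt0n totient_gt0.
transitivity ((totient k)%:R^-1 * \sum_(r <- divisors m) hmu h j r *
   (g%:R^-1 * \sum_(d <- divisors k | (r %/ gcdn r b %| d)%N) 'mu d / d%:R)).
  congr (_ * _); under [RHS]eq_bigr => r _ do rewrite mulrA mulr_sumr.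
  rewrite (exchange_big_dep xpredT) //= !big_seq; apply: eq_bigr => d.
  rewrite -dvdn_divisors // => dk.
  have d0 := dvdn_gt0 k0 dk.
  have dK : d%:R != 0 :> K by rewrite pnatr_eq0 -lt0n.
  have dgm : (d * g %| m)%N by rewrite kg dvdn_pmul2r.
  rewrite -sum_hmu ?muln_gt0 ?d0 // (sum_divisors_sub _ m0 dgm).
  rewrite mulr_suml mulr_sumr big_seq_cond [RHS]big_seq_cond.
  apply: eq_big => [r|r _].
    (* [r | d g] amounts to [r / gcd (r, b) | d], as [gcd (r, b) = gcd (r, g)]. *)
    case rm : (r \in divisors m) => //=; move: rm; rewrite -dvdn_divisors // => rm.
    have r0 := dvdn_gt0 m0 rm.
    have rb0 : (0 < gcdn r b)%N by rewrite gcdn_gt0 r0.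
    have rbg : gcdn r b = gcdn r g.
      by rewrite /g gcdnA; have /gcdn_idPl := dvdn_trans (dvdn_gcdl r b) rm.
    apply/idP/idP => [rdg|].
      rewrite rbg; have rg0 : (0 < gcdn r g)%N by rewrite -rbg.
      rewrite -(dvdn_pmul2r rg0) divnK ?dvdn_gcdl // muln_gcdr dvdn_gcd rdg.
      by rewrite dvdn_mull.
    move=> sd; rewrite -(divnK (dvdn_gcdl r b)); apply: dvdn_mul => //.
    by rewrite rbg dvdn_gcdr.
  by rewrite natrM; field; rewrite dK gK.
rewrite mulr_sumr [RHS]mulr_sumr !big_seq; apply: eq_bigr => r.
rewrite -dvdn_divisors // => rm; have r0 := dvdn_gt0 m0 rm.
have rb0 : (0 < gcdn r b)%N by rewrite gcdn_gt0 r0.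
set s := (r %/ gcdn r b)%N.
have rbg : gcdn r b = gcdn r g.
  by rewrite /g gcdnA; have /gcdn_idPl := dvdn_trans (dvdn_gcdl r b) rm.
have sk : (s %| k)%N.
  have cs : coprime s (g %/ gcdn r g).
    rewrite /s rbg /coprime -(@eqn_pmul2r (gcdn r g)) ?mul1n; last by rewrite -rbg.
    by rewrite muln_gcdl !divnK ?dvdn_gcdl ?dvdn_gcdr.
  rewrite -(Gauss_dvdl _ cs) -(dvdn_pmul2r rb0) /s divnK ?dvdn_gcdl //.
  by rewrite -mulnA rbg divnK ?dvdn_gcdr // -kg.
have s0 := dvdn_gt0 k0 sk.
have sK : (totient s)%:R != 0 :> K by rewrite pnatr_eq0 -lt0n totient_gt0.
rewrite sum_moebius_multiples // /ramanujan -/s {1}kg natrM.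
by field; rewrite gK kK sK tK.
Qed.

(** Here [E] bounds the error on the multiples of each divisor of [m], [V j]
    stands for [U_j(y)] and [B] for the integer part of [y] plus 1. *)
Lemma gcd_class_sum f h J m b B E (V : nat -> K) : (0 < m)%N ->
  (forall e, (e %| m)%N ->
     `|\sum_(1 <= n < B | (e %| n)%N) f n
       - \sum_(0 <= j < J) h j e / e%:R * V j| <= E) ->
  `|(totient (m %/ gcdn b m))%:R^-1 *
      \sum_(1 <= n < B | gcdn n m == gcdn b m) f n
    - \sum_(0 <= j < J) V j *
        (m%:R^-1 * \sum_(r <- divisors m) hmu h j r * ramanujan K r b)|
  <= tau_phi K (m %/ gcdn b m) * E.
Proof.
move=> m0 HE; rewrite sum_gcd_eq //; set g := gcdn b m.
have g0 : (0 < g)%N by rewrite gcdn_gt0 m0 orbT.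
have gm : (g %| m)%N := dvdn_gcdr b m.
set k := (m %/ g)%N; have kg : m = (k * g)%N by rewrite divnK.
have k0 : (0 < k)%N by rewrite divn_gt0 // dvdn_leq.
have E0 : 0 <= E by exact: le_trans (normr_ge0 _) (HE 1%N (dvd1n _)).
have -> : \sum_(0 <= j < J) V j *
        (m%:R^-1 * \sum_(r <- divisors m) hmu h j r * ramanujan K r b) =
    (totient k)%:R^-1 * \sum_(d <- divisors k) 'mu d *
      \sum_(0 <= j < J) h j (d * g)%N / (d * g)%:R * V j.
  under eq_bigr => j _ do rewrite -(main_term_eq h j b m0) /= mulrCA.
  rewrite -mulr_sumr; congr (_ * _).
  under eq_bigr => j _ do rewrite mulr_sumr.
  rewrite exchange_big /=; apply: eq_bigr => d _; rewrite mulr_sumr.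
  apply: eq_bigr => j _.
  by rewrite -/g [RHS]mulrA [RHS]mulrC.
rewrite -mulrBr -sumrB tau_phiE mulr_suml normrM normfV normr_nat.
rewrite -mulr_sumr; apply: ler_wpM2l; first by rewrite invr_ge0.
apply: (le_trans (ler_norm_sum _ _ _)); rewrite !big_seq; apply: ler_sum => d.
rewrite -dvdn_divisors // => dk; rewrite -mulrBr normrM -[leRHS]mul1r.
apply: ler_pM => //; first exact: normr_moebius_le1.
by apply: HE; rewrite kg dvdn_pmul2r.
Qed.

End Sequence.

(** * The error for one modulus *)

Section OneModulus.
Variable K : realType.
Implicit Types (f w : nat -> K) (h : nat -> nat -> K) (u : nat -> K -> K).
Implicit Types (Q L : K -> K) (x y R E : K) (J j n m b d e r B q a : nat).

Lemma as_error_ge0 u Q L x : 0 <= as_error u Q L x.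
Proof. exact: normr_ge0. Qed.

Lemma u1_star_ge0 J h u x R : 0 <= u1_star J h u x R.
Proof.
apply: sumr_ge0 => j _; apply: mulr_ge0; first by rewrite addr_ge0.
by apply: sumr_ge0 => r _; rewrite divr_ge0 // mulr_ge0.
Qed.

(** A constant [B] with [|u j 0| + |u j x| <= B (|u j x| + 1)] for all [j < J]. *)
Definition init_bound J u : K := 1 + \sum_(0 <= j < J) `|u j 0|.

Lemma init_bound_ge0 J u : 0 <= init_bound J u.
Proof. by rewrite addr_ge0 // sumr_ge0. Qed.

Lemma init_boundP J u j x : (j < J)%N ->
  `|u j 0| + `|u j x| <= init_bound J u * (`|u j x| + 1).
Proof.
move=> jJ; have H : 1 + `|u j 0| <= init_bound J u.
  rewrite lerD2l (bigD1_seq j) ?iota_uniq ?mem_index_iota //= lerDl.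
  exact: sumr_ge0.
apply: (@le_trans _ _ ((1 + `|u j 0|) * (`|u j x| + 1))); last first.
  by apply: ler_wpM2r => //; rewrite addr_ge0.
have := mulr_ge0 (normr_ge0 (u j 0)) (normr_ge0 (u j x)).
by rewrite mulrDl mul1r mulrDr mulr1; lra.
Qed.

Lemma sum_init_boundP J h u x R :
  \sum_(0 <= j < J) (`|u j 0| + `|u j x|) *
     \sum_(1 <= r < (Num.truncn R).+1) `|hmu h j r| * r%:R / (totient r)%:R
  <= init_bound J u * u1_star J h u x R.
Proof.
rewrite /u1_star mulr_sumr [leLHS]big_nat_cond [leRHS]big_nat_cond.
apply: ler_sum => j; rewrite andbT => /andP[_ jJ]; rewrite mulrA.
apply: ler_wpM2r; last exact: init_boundP.
by apply: sumr_ge0 => r _; rewrite divr_ge0 // mulr_ge0.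
Qed.

Lemma norm_h_le h j e R : (0 < e < (Num.truncn R).+1)%N ->
  `|h j e| <= \sum_(1 <= r < (Num.truncn R).+1) `|hmu h j r| * r%:R / (totient r)%:R.
Proof.
case/andP=> e0 eR; rewrite -sum_hmu // (sum_divisors_range _ e0 eR).
apply: (le_trans (ler_norm_sum _ _ _)); rewrite big_mkcond.
rewrite [leLHS]big_nat_cond [leRHS]big_nat_cond; apply: ler_sum => r.
rewrite andbT => /andP[r0 _].
have tK : 0 < (totient r)%:R :> K by rewrite ltr0n totient_gt0.
case: ifP => _; last by rewrite divr_ge0 // mulr_ge0.
rewrite -mulrA ler_peMr // ler_pdivlMr // mul1r ler_nat.
rewrite totient_count_coprime.
apply: (@leq_trans (\sum_(0 <= d < r) 1)); last by rewrite sum_nat_const_nat subn0 muln1.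
by apply: leq_sum => d _; exact: leq_b1.
Qed.

(** The factor [y / e] makes this usable when [y < e], outside the range of the
    hypothesis on the sequence. *)
Lemma main_term_le J h u e x y R :
  (forall j, (j < J)%N -> smooth_nneg (u j) /\ monotonic_nneg (u j)) ->
  0 <= y -> y <= x -> (0 < e < (Num.truncn R).+1)%N ->
  `|\sum_(0 <= j < J) h j e / e%:R * Uint u j y|
  <= y / e%:R * (init_bound J u * u1_star J h u x R).
Proof.
move=> uP y0 yx eR.
have eK : 0 < e%:R :> K by rewrite ltr0n; case/andP: eR.
apply: (@le_trans _ _ (y / e%:R * \sum_(0 <= j < J) (`|u j 0| + `|u j x|) *
  \sum_(1 <= r < (Num.truncn R).+1) `|hmu h j r| * r%:R / (totient r)%:R)); last first.
  by apply: ler_wpM2l; [rewrite divr_ge0 // ltW|exact: sum_init_boundP].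
apply: (le_trans (ler_norm_sum _ _ _)); rewrite mulr_sumr.
rewrite [leLHS]big_nat_cond [leRHS]big_nat_cond; apply: ler_sum => j.
rewrite andbT => /andP[_ jJ]; have [sj mj] := uP _ jJ.
rewrite !normrM normfV (gtr0_norm eK).
have H1 := norm_h_le h j eR; have H2 := normr_integral_le sj mj y0 yx.
have -> : forall S V : K, y / e%:R * (V * S) = S / e%:R * (y * V).
  by move=> S V; move: (e%:R^-1) => q; ring.
apply: ler_pM => //.
by rewrite ler_pM2r ?invr_gt0.
Qed.

(** Error of the expected main term for the multiples of [e], for all [y <= x]
    and [e <= R]. For [y < e] the sum is empty and the main term is itself
    bounded by [u1_star]. For [2 <= y] and [e <= y] the hypothesis at [y]
    applies, and its error term is dominated by the one at [x]. What remains is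
    [e = 1] and [1 <= y < 2], where the sum is the constant [f 1]. *)
Lemma sum_dvd_error f J h u Q L :
  arithmetical_sequence f J h u Q L -> regular_scale u Q L ->
  exists2 C : K, 0 <= C & forall x y R e,
    1 <= x -> 0 <= y -> y <= x -> L x != 0 -> ln (Q x) != 0 -> 2 <= R ->
    (0 < e < (Num.truncn R).+1)%N ->
    `|\sum_(1 <= n < (Num.truncn y).+1 | (e %| n)%N) f n
      - \sum_(0 <= j < J) h j e / e%:R * Uint u j y|
    <= C * (as_error u Q L x + u1_star J h u x R).
Proof.
case=> uP' [C0 AS] [scale [C1 reg]].
have uP j : (j < J)%N -> smooth_nneg (u j) /\ monotonic_nneg (u j).
  by move=> /uP'[].
pose c0 := `|C0|; pose c1 := `|C1|; pose B := init_bound J u.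
have c00 : 0 <= c0 by exact: normr_ge0.
have c10 : 0 <= c1 by exact: normr_ge0.
have B0 : 0 <= B := init_bound_ge0 J u.
exists (c0 + 2 * c0 * c1 + 6 * B).
  by rewrite !addr_ge0 ?mulr_ge0.
move=> x y R e x1 y0 yx Lx Qx R2 eR.
have x0 : 0 <= x by lra.
set as_ := as_error u Q L x; set u1 := u1_star J h u x R.
have as0 : 0 <= as_ := as_error_ge0 u Q L x.
have u10 : 0 <= u1 := u1_star_ge0 J h u x R.
pose S e y := \sum_(1 <= n < (Num.truncn y).+1 | (e %| n)%N) f n.
pose M e y := \sum_(0 <= j < J) h j e / e%:R * Uint u j y.
have AS' e' y' : (1 <= e')%N -> e'%:R <= y' -> 2 <= y' -> y' <= x ->
    `|S e' y' - M e' y'| <= c0 * c1 * as_.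
  move=> e1 ey y2 yx'; have [Ly Qy] := scale _ y2.
  apply: (le_trans (AS y' e' e1 ey _ _)).
  - by rewrite gt_eqF.
  - by rewrite gt_eqF // ln_gt0.
  apply: (@le_trans _ _ (c0 * as_error u Q L y')).
    by apply: ler_wpM2r; [exact: as_error_ge0|exact: ler_norm].
  rewrite -mulrA; apply: ler_wpM2l => //; apply: (le_trans (reg _ _ y2 yx')).
  by apply: ler_wpM2r; [exact: as_error_ge0|exact: ler_norm].
have MB e' y' : (0 < e' < (Num.truncn R).+1)%N -> 0 <= y' -> y' <= x -> y' <= 2 * e'%:R ->
    `|M e' y'| <= 2 * (B * u1).
  move=> e1 y'0 y'x y'2; have eK : 0 < e'%:R :> K by rewrite ltr0n; case/andP: e1.
  apply: (le_trans (main_term_le h uP y'0 y'x e1)).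
  apply: ler_wpM2r; first by rewrite mulr_ge0.
  by rewrite ler_pdivrMr.
have tR : (1 < Num.truncn R)%N by rewrite truncn_gt_nat.
(* For [x < 2] the hypothesis at [x] controls [f 1]. Otherwise the hypothesis
   at 2 does, for the divisors 1 and 2: it controls [f 1 + f 2] and [f 2]. *)
have f1 : `|f 1%N| <= (c0 + 2 * (c0 * c1)) * as_ + 4 * (B * u1).
  have a1 := mulr_ge0 c00 as0; have a2 := mulr_ge0 (mulr_ge0 c00 c10) as0.
  have a3 := mulr_ge0 B0 u10.
  have [x2|x2] := ltP x 2.
    have Sx : S 1%N x = f 1%N.
      rewrite /S (@truncn_def _ x 1) ?x1 // big_mkcond big_nat1 //.
    have := AS x 1%N isT x1 Lx Qx; rewrite -/(S _ _) -/(M _ _) -/as_ Sx => H.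
    have H' : `|f 1%N - M 1%N x| <= c0 * as_.
      by apply: (le_trans H); apply: ler_wpM2r => //; exact: ler_norm.
    have HM : `|M 1%N x| <= 2 * (B * u1) by apply: MB; rewrite ?mulr1 ?ltnS ?(ltnW tR) // ltW.
    rewrite -[f 1%N](subrK (M 1%N x)); apply: (le_trans (ler_normD _ _)).
    by rewrite mulrDl -mulrA; lra.
  have t2 : Num.truncn (2 : K) = 2%N by exact: (natrK 2%N).
  have S1 : S 1%N 2 = f 1%N + f 2%N.
    by rewrite /S t2 big_mkcond big_nat_recr //= big_nat1.
  have S2 : S 2%N 2 = f 2%N.
    by rewrite /S t2 big_mkcond big_nat_recr //= big_nat1 add0r.
  have K2 : (2 : K) <= 2 by [].
  have H1 := AS' 1%N 2 isT (ler1n _ _) K2 x2.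
  have H2 := AS' 2%N 2 isT K2 K2 x2.
  have M1 : `|M 1%N 2| <= 2 * (B * u1) by apply: MB; rewrite ?mulr1 ?ltnS ?(ltnW tR).
  have M2 : `|M 2%N 2| <= 2 * (B * u1) by apply: MB; rewrite ?ltnS //; lra.
  rewrite S1 in H1; rewrite S2 in H2.
  have -> : f 1%N = (f 1%N + f 2%N - M 1%N 2) - (f 2%N - M 2%N 2) + M 1%N 2 - M 2%N 2 by ring.
  apply: (le_trans (ler_normB _ _)); apply: (le_trans (lerD (ler_normD _ _) (lexx _))).
  apply: (le_trans (lerD (lerD (ler_normB _ _) (lexx _)) (lexx _))).
  by rewrite mulrDl -mulrA; lra.
have a1 := mulr_ge0 c00 as0; have a2 := mulr_ge0 (mulr_ge0 c00 c10) as0.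
have a3 := mulr_ge0 B0 u10; have a4 := mulr_ge0 B0 as0.
have a5 := mulr_ge0 c00 u10; have a6 := mulr_ge0 (mulr_ge0 c00 c10) u10.
have e0 : (0 < e)%N by case/andP: eR.
have eK : 0 < e%:R :> K by rewrite ltr0n.
rewrite -/(S e y) -/(M e y) -/as_ -/u1.
have -> : (c0 + 2 * c0 * c1 + 6 * B) * (as_ + u1) =
  c0 * as_ + 2 * (c0 * c1 * as_) + 6 * (B * as_) + c0 * u1 + 2 * (c0 * c1 * u1) + 6 * (B * u1).
  by ring.
have [ye|ey] := ltP y e%:R.
  have -> : S e y = 0.
    rewrite /S big1_seq // => n /andP[en]; rewrite mem_index_iota => /andP[n0 ny].
    have : n%:R <= y by rewrite -truncn_ge_nat.
    have : e%:R <= n%:R :> K by rewrite ler_nat dvdn_leq.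
    by lra.
  rewrite sub0r normrN.
  have : `|M e y| <= 2 * (B * u1) by apply: MB => //; lra.
  by lra.
have [y2|y2] := ltP y 2; last first.
  by have := AS' e y e0 ey y2 yx; lra.
have e1 : e = 1%N.
  apply/eqP; rewrite eqn_leq e0 andbT -ltnS -(ltr_nat K).
  exact: le_lt_trans ey y2.
have Sy : S e y = f 1%N.
  by rewrite e1 /S (@truncn_def _ y 1) ?big_mkcond ?big_nat1 // y2 andbT; move: ey; rewrite e1.
apply: (le_trans (ler_normB _ _)); rewrite Sy.
have : `|M e y| <= 2 * (B * u1) by apply: MB => //; rewrite e1 mulr1 ltW.
by lra.
Qed.

End OneModulus.

(** * Summation over the moduli *)

Section Moduli.
Variable K : realType.
Implicit Types (f : nat -> K) (h : nat -> nat -> K) (u : nat -> K -> K).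
Implicit Types (Q L : K -> K) (x y R N : K) (J j n m b q a M : nat).

Lemma ap_discrepancy_le_max f q a x y : (1 <= a <= q)%N -> y <= x ->
  ap_discrepancy f q a y <= max_ap_discrepancy f q x.
Proof.
move=> aq yx; apply: ub_le_sup; last by exists y, a.
pose D a T := `| \sum_(1 <= n < T.+1 | n == a %[mod q]) f n
     - (totient (q %/ gcdn q a))%:R^-1 *
       \sum_(1 <= n < T.+1 | gcdn n q == gcdn a q) f n |.
(* The discrepancy depends only on [a <= q] and on the integer part [T] of [y],
   so it takes finitely many values. *)
exists (\sum_(0 <= T < (Num.truncn x).+1) \sum_(0 <= a < q.+1) D a T).
move=> z [y' [a' [y'x /andP[a1 a'q] ->]]].
have Tx : (Num.truncn y' <= Num.truncn x)%N := le_truncn y'x.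
rewrite (bigD1_seq (Num.truncn y')) ?iota_uniq ?mem_index_iota //=.
rewrite (bigD1_seq a') ?iota_uniq ?mem_index_iota //=.
rewrite -addrA lerDl addr_ge0 //; first by apply: sumr_ge0 => i _; exact: normr_ge0.
by apply: sumr_ge0 => T _; apply: sumr_ge0 => i _; exact: normr_ge0.
Qed.

Lemma max_ap_discrepancy_ge0 f q x : (0 < q)%N -> 0 <= max_ap_discrepancy f q x.
Proof.
move=> q0; apply: le_trans (ap_discrepancy_le_max f (a := 1) _ (lexx x)).
  exact: normr_ge0.
by rewrite q0.
Qed.

(** The error in one residue class, as the sum of the equidistribution
    discrepancy, of the sieving error for [f] and of the error for [F_R]. *)
Lemma one_modulus_error f J h u Q L :
  arithmetical_sequence f J h u Q L -> regular_scale u Q L ->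
  exists2 C : K, 0 <= C & forall x y R m b,
    1 <= x -> 0 <= y -> y <= x -> L x != 0 -> ln (Q x) != 0 -> 2 <= R ->
    (0 < m < (Num.truncn R).+1)%N -> (1 <= b <= m)%N ->
    `|\sum_(1 <= n < (Num.truncn y).+1 | n == b %[mod m]) (f n - FR J h u R n)|
    <= max_ap_discrepancy f m x
       + C * (tau_phi K (m %/ gcdn b m) * (as_error u Q L x + u1_star J h u x R)
              + (1 + ln R) * u1_star J h u x R).
Proof.
move=> AS reg; have [C C0 HC] := sum_dvd_error AS reg.
have uP j : (j < J)%N -> smooth_nneg (u j) /\ monotonic_nneg (u j).
  by case: AS => H _ /H[].
set B := init_bound J u; have B0 : 0 <= B := init_bound_ge0 J u.
exists (C + 10 * B); first by rewrite addr_ge0 // mulr_ge0.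
move=> x y R m b x1 y0 yx Lx Qx R2 mR bm.
have m0 : (0 < m)%N by case/andP: mR.
have R1 : 1 <= R by lra.
set u1 := u1_star J h u x R; set as_ := as_error u Q L x.
set t := tau_phi K _.
have u10 : 0 <= u1 := u1_star_ge0 J h u x R.
have as0 : 0 <= as_ := as_error_ge0 u Q L x.
have t0 : 0 <= t := tau_phi_ge0 K _.
have lR : 0 <= 1 + ln R by rewrite addr_ge0 // ln_ge0.
rewrite sumrB.
set Sf := \sum_(_ <= _ < _ | _) f _; set SF := \sum_(_ <= _ < _ | _) FR _ _ _ _ _.
have H1 := ap_discrepancy_le_max f bm yx.
rewrite /ap_discrepancy -/Sf [gcdn m b]gcdnC in H1.
have HE e : (e %| m)%N -> `|\sum_(1 <= n < (Num.truncn y).+1 | (e %| n)%N) f n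
    - \sum_(0 <= j < J) h j e / e%:R * Uint u j y| <= C * (as_ + u1).
  move=> em; apply: HC => //; rewrite (dvdn_gt0 m0 em) /=.
  by case/andP: mR => _; apply: leq_ltn_trans; exact: dvdn_leq.
have H2 := gcd_class_sum b m0 HE.
have H3 := FR_ap_sum h b uP y0 yx R1 mR; rewrite -/SF in H3.
have {}H3 : `|SF - \sum_(0 <= j < J) Uint u j y *
    (m%:R^-1 * \sum_(r <- divisors m) hmu h j r * ramanujan K r b)| <=
    10 * (1 + ln R) * (B * u1).
  apply: (le_trans H3).
  have := sum_init_boundP J h u x R; rewrite -/B -/u1 => H.
  apply: le_trans (ler_wpM2l (mulr_ge0 (ler0n K 10) lR) H).
  rewrite mulr_sumr; apply: ler_sum => j _.
  by rewrite le_eqVlt; apply/orP; left; apply/eqP; ring.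
rewrite -/t in H2.
move: H1 H2 H3; set G := (_^-1 * _); set P := \sum_(0 <= j < J) _ => H1 H2 H3.
have -> : Sf - SF = (Sf - G) + (G - P) - (SF - P) by ring.
apply: (le_trans (ler_normB _ _)); apply: (le_trans (lerD (ler_normD _ _) (lexx _))).
have -> : max_ap_discrepancy f m x + (C + 10 * B) * (t * (as_ + u1) + (1 + ln R) * u1) =
  max_ap_discrepancy f m x + t * (C * (as_ + u1)) + 10 * (1 + ln R) * (B * u1)
  + (10 * B * (t * (as_ + u1)) + C * ((1 + ln R) * u1)) by ring.
apply: (@le_trans _ _ (max_ap_discrepancy f m x + t * (C * (as_ + u1)) +
    10 * (1 + ln R) * (B * u1))).
  by apply: lerD => //; apply: lerD.
by rewrite lerDl addr_ge0 // !mulr_ge0 // addr_ge0.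
Qed.

Lemma ln_ge_bound x : 2 <= x -> 1 + ln x <= (1 + (ln 2)^-1) * ln x.
Proof.
move=> x2; have l2 : 0 < ln 2 :> K by rewrite ln_gt0 // ltr1n.
rewrite mulrDl mul1r addrC lerD2l mulrC ler_pdivlMr // mul1r.
by rewrite ler_ln ?posrE ?ltr0n //; lra.
Qed.

Lemma sum_inv_totient_range_le M x : 2 <= x -> (M <= Num.truncn x)%N ->
  \sum_(1 <= d < M.+1) (totient d)%:R^-1 <= 4 * (1 + (ln 2)^-1) * ln x.
Proof.
move=> x2 Mx; have x0 : 0 < x by lra.
have t0 : (0 < Num.truncn x)%N by rewrite truncn_gt0; lra.
apply: (@le_trans _ _ (\sum_(1 <= d < (Num.truncn x).+1) (totient d)%:R^-1)).
  rewrite [leRHS](@big_cat_nat _ _ _ M.+1) //= lerDl; apply: sumr_ge0 => d _.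
  by rewrite invr_ge0.
apply: (le_trans (sum_inv_totient_le K t0)); rewrite -mulrA ler_pM2l ?ltr0n //.
apply: le_trans (ln_ge_bound x2).
by rewrite lerD2l ler_ln ?posrE ?ltr0n // truncn_le ltW.
Qed.

(** The endpoint [y m] and the residue [b m] may depend on the modulus [m]; of
    the latter only the gcd with [m] matters. *)
Lemma sum_moduli_error f J h u Q L :
  arithmetical_sequence f J h u Q L -> equidistribution f u Q L ->
  regular_scale u Q L ->
  exists2 C : K, 0 <= C & forall x N R M a (b : nat -> nat) (y : nat -> K),
    1 <= x -> L x != 0 -> 2 <= Q x -> 2 <= R -> (0 < a)%N ->
    (M <= Num.truncn (Q x))%N -> (M <= Num.truncn R)%N -> M%:R <= 2 * N ->
    (forall m, (0 < m <= M)%N -> [/\ (1 <= b m <= m)%N,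
        gcdn (b m) m = gcdn m a, 0 <= y m & y m <= x]) ->
    \sum_(1 <= m < M.+1)
      `|\sum_(1 <= n < (Num.truncn (y m)).+1 | n == b m %[mod m]) (f n - FR J h u R n)|
    <= C * (N * ln R * u1_star J h u x R + (ntau a)%:R * `|Uint u 0 x / L x|).
Proof.
move=> AS [C1 EQ] reg; have [C C0 HC] := one_modulus_error AS reg.
have l2 : 0 < ln 2 :> K by rewrite ln_gt0 // ltr1n.
pose c : K := 1 + (ln 2)^-1.
have c0 : 0 <= c by rewrite addr_ge0 // invr_ge0 ltW.
exists (`|C1| + C * (16 * c ^+ 2) + C * (10 * c)).
  by rewrite !addr_ge0 // ?mulr_ge0 // exprn_ge0.
move=> x N R M a b y x1 Lx Q2 R2 a0 MQ MR MN by_.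
have lQ : 0 < ln (Q x) by apply: ln_gt0; lra.
have lR : 0 < ln R by apply: ln_gt0; lra.
set u1 := u1_star J h u x R; set as_ := as_error u Q L x; set UL := `|_ / L x|.
have u10 : 0 <= u1 := u1_star_ge0 J h u x R.
have as0 : 0 <= as_ := as_error_ge0 u Q L x.
have UL0 : 0 <= UL := normr_ge0 _.
have asE : as_ * ln (Q x) ^+ 2 = UL.
  rewrite /as_ /as_error /UL [(L x * _)^-1]invfM [Uint u 0 x * _]mulrA.
  rewrite [X in X * _]normrM [X in _ * X * _]normfV.
  by rewrite [X in _ / X * _]ger0_norm ?exprn_ge0 ?(ltW lQ) // mulfVK // expf_neq0 // gt_eqF.
have N0 : 0 <= N by have := ler0n K M; lra.
have tau1 : 1 <= (ntau a)%:R :> K.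
  rewrite ler1n /ntau; case: divisors (divisor1 a) => //.
have M1 : \sum_(1 <= m < M.+1) max_ap_discrepancy f m x <= `|C1| * UL.
  apply: (@le_trans _ _ (C1 * UL)); last by apply: ler_wpM2r => //; exact: ler_norm.
  apply: le_trans (EQ x x1 Lx).
  rewrite [leRHS](@big_cat_nat _ _ _ M.+1) //= lerDl big_nat_cond.
  apply: sumr_ge0 => d; rewrite andbT => /andP[d0 _].
  by apply: max_ap_discrepancy_ge0; exact: leq_ltn_trans d0.
pose T m := tau_phi K (m %/ gcdn m a).
(* The factor [ln (Q x) ^ 2] saved in [as_] is used up here. *)
have M2 : \sum_(1 <= m < M.+1) T m * as_ <= 16 * c ^+ 2 * ((ntau a)%:R * UL).
  rewrite -mulr_suml -asE.
  have -> : 16 * c ^+ 2 * ((ntau a)%:R * (as_ * ln (Q x) ^+ 2)) =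
    (ntau a)%:R * ((4 * c * ln (Q x)) ^+ 2) * as_ by ring.
  apply: ler_wpM2r => //.
  apply: (le_trans (sum_div_gcd_le _ a0 (tau_phi_ge0 K))).
  apply: ler_wpM2l => //; apply: (le_trans (sum_tau_phi_le K _)).
  have S := sum_inv_totient_range_le Q2 MQ.
  rewrite lerXn2r ?nnegrE //; last by rewrite !mulr_ge0 // ltW.
  by apply: sumr_ge0 => d _; rewrite invr_ge0.
have M3 : \sum_(1 <= m < M.+1) (T m * u1 + (1 + ln R) * u1) <= 10 * c * (N * ln R * u1).
  apply: (@le_trans _ _ (\sum_(1 <= m < M.+1) 5 * c * ln R * u1)).
    rewrite [leLHS]big_nat_cond [leRHS]big_nat_cond.
    apply: ler_sum => m; rewrite andbT ltnS => /andP[m0 mM].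
    rewrite -mulrDl; apply: ler_wpM2r => //.
    have g0 : (0 < gcdn m a)%N by rewrite gcdn_gt0 m0.
    have kM : (0 < m %/ gcdn m a < M.+1)%N.
      rewrite divn_gt0 // dvdn_leq ?dvdn_gcdl //= ltnS.
      exact: leq_trans (leq_div _ _) mM.
    have := tau_phi_le K kM; have := sum_inv_totient_range_le R2 MR.
    have := ln_ge_bound R2; rewrite -/c /T; lra.
  rewrite sumr_const_nat subn1 /= -[leLHS]mulr_natl.
  have -> : 10 * c * (N * ln R * u1) = 2 * N * (5 * c * ln R * u1) by ring.
  by apply: ler_wpM2r => //; rewrite !mulr_ge0 // ltW.
apply: (@le_trans _ _ (\sum_(1 <= m < M.+1) (max_ap_discrepancy f m x +
   C * (T m * as_ + (T m * u1 + (1 + ln R) * u1))))).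
  rewrite [leLHS]big_nat_cond [leRHS]big_nat_cond.
  apply: ler_sum => m; rewrite andbT ltnS => /andP[m0 mM].
  have [bm gE y0 yx] : [/\ (1 <= b m <= m)%N, gcdn (b m) m = gcdn m a, 0 <= y m & y m <= x].
    by apply: by_; rewrite m0.
  have mR : (0 < m < (Num.truncn R).+1)%N by rewrite m0 ltnS (leq_trans mM).
  have := HC x (y m) R m (b m) x1 y0 yx Lx _ R2 mR bm.
  rewrite gt_eqF // gE => /(_ isT) H; apply: (le_trans H).
  by rewrite -/as_ -/u1 -/(T m) [T m * (_ + _)]mulrDr -[T m * as_ + _ + _]addrA.
rewrite big_split /= -mulr_sumr big_split /=.
have CM2 := ler_wpM2l C0 M2; have CM3 := ler_wpM2l C0 M3.
rewrite mulrDr.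
have P1 : 0 <= N * ln R * u1 by rewrite !mulr_ge0 // ltW.
have P2 : UL <= (ntau a)%:R * UL by rewrite ler_peMl.
have P3 := ler_wpM2l (normr_ge0 C1) P2.
have P4 : 0 <= (ntau a)%:R * UL by rewrite mulr_ge0.
have P5 : 0 <= `|C1| * (N * ln R * u1) by apply: mulr_ge0.
have P6 : 0 <= C * (16 * c ^+ 2 * (N * ln R * u1)).
  by apply: mulr_ge0 => //; apply: mulr_ge0 => //; apply: mulr_ge0;
    rewrite ?exprn_ge0.
have P7 : 0 <= C * (10 * c * ((ntau a)%:R * UL)).
  by apply: mulr_ge0 => //; apply: mulr_ge0 => //; apply: mulr_ge0.
have -> : (`|C1| + C * (16 * c ^+ 2) + C * (10 * c)) *
    (N * ln R * u1 + (ntau a)%:R * UL) =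
  `|C1| * (N * ln R * u1) + `|C1| * ((ntau a)%:R * UL) +
  C * (16 * c ^+ 2 * (N * ln R * u1)) + C * (16 * c ^+ 2 * ((ntau a)%:R * UL)) +
  C * (10 * c * (N * ln R * u1)) + C * (10 * c * ((ntau a)%:R * UL)) by ring.
move: P3 P5 P6 P7 CM2 CM3 M1.
move: (\sum_(_ <= _ < _) max_ap_discrepancy _ _ _) (C * \sum_(_ <= _ < _) T _ * as_) => s1 s2.
move: (C * \sum_(_ <= _ < _) _) => s3.
move: (`|C1| * ((ntau a)%:R * UL)) (C * (16 * c ^+ 2 * ((ntau a)%:R * UL))) => z1 z2.
move: (C * (10 * c * (N * ln R * u1))) => z3.
move: (`|C1| * (N * ln R * u1)) (C * (16 * c ^+ 2 * (N * ln R * u1))) => z4 z5.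
move: (C * (10 * c * ((ntau a)%:R * UL))) (`|C1| * UL) => z6 z7.
clear; lra.
Qed.

End Moduli.

(** * Exchanging the modulus and its cofactor *)

Section Switching.
Variable K : realType.
Implicit Types (G : nat -> K) (x N y : K) (n m q k M T A H B : nat) (a : int).

Lemma sum_range_divisors k B (P : pred nat) (F : nat -> K) : (0 < k)%N ->
  \sum_(1 <= q < B | (q %| k)%N && P q) F q =
  \sum_(q <- divisors k | (q < B)%N && P q) F q.
Proof.
move=> k0; rewrite -big_filter -[RHS]big_filter; apply: perm_big.
apply: uniq_perm; rewrite ?filter_uniq ?iota_uniq ?divisors_uniq // => q.
rewrite !mem_filter mem_index_iota -dvdn_divisors //.
case qk: (q %| k)%N; rewrite ?andbF //= (dvdn_gt0 k0 qk) andbT /=.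
by rewrite andbC.
Qed.

(** The representative of [a] modulo [m] in [1, m], for [m > 0]. *)
Definition residue a m : nat :=
  let r := `|(a %% m%:Z)%Z|%N in if r == 0%N then m else r.

Lemma residueE a m : (0 < m)%N -> ((residue a m)%:Z %% m%:Z)%Z = (a %% m%:Z)%Z.
Proof.
move=> m0; rewrite /residue.
have aE : (`|(a %% m%:Z)%Z|%N)%:Z = (a %% m%:Z)%Z.
  by rewrite gez0_abs // modz_ge0 // eqz_nat -lt0n.
case: eqP => [r0|_]; last by rewrite aE modz_mod.
by rewrite -aE r0 modzz.
Qed.

Lemma residue_bounds a m : (0 < m)%N -> (1 <= residue a m <= m)%N.
Proof.
move=> m0; rewrite /residue; case: eqP => [_|/eqP r0]; first by rewrite m0 /=.
rewrite lt0n r0 /= ltnW // -ltz_nat gez0_abs ?ltz_pmod //.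
by rewrite modz_ge0 // eqz_nat -lt0n.
Qed.

Lemma eqn_mod_residue a m n : (0 < m)%N ->
  (n%:Z == a %[mod m%:Z])%Z = (n == residue a m %[mod m]).
Proof.
by move=> m0; rewrite -(residueE a m0) !modz_nat.
Qed.

Lemma gcdn_residue a m : (0 < m)%N -> gcdn (residue a m) m = gcdn m `|a|.
Proof.
move=> m0; have : gcdz (residue a m)%:Z m%:Z = gcdz a m%:Z.
  by rewrite -gcdz_modl residueE // gcdz_modl.
by move=> /eqP; rewrite /gcdz eqz_nat !absz_nat => /eqP ->; rewrite gcdnC.
Qed.

Lemma sum_interval G (P : pred nat) T A H : (A <= H)%N -> (H <= T)%N ->
  \sum_(1 <= n < T.+1 | P n && (A < n <= H)%N) G n =
  \sum_(1 <= n < H.+1 | P n) G n - \sum_(1 <= n < A.+1 | P n) G n.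
Proof.
move=> AH HT.
rewrite (@big_cat_nat _ _ _ H.+1) //= [X in _ + X]big1_seq ?addr0; last first.
  move=> n /andP[/and3P[_ _ nH]]; rewrite mem_index_iota => /andP[Hn _].
  by rewrite leqNgt Hn in nH.
rewrite (@big_cat_nat _ _ _ A.+1) //= big1_seq ?add0r; last first.
  move=> n /andP[/and3P[_ An _]]; rewrite mem_index_iota => /andP[_ nA].
  by rewrite ltnNge -ltnS nA in An.
rewrite [X in _ = X - _](@big_cat_nat _ _ _ A.+1) //= [RHS]addrC addKr.
rewrite big_nat_cond [RHS]big_nat_cond; apply: eq_bigl => n.
case: (P n); rewrite ?andbF //= !andbT.
by case: (ltnP A n) => //= An; rewrite ltnS andbb.
Qed.

(** For a fixed [k = n - a] the modulus [q] and its cofactor [m = k / q] range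
    over complementary divisors of [k]. *)
Lemma sum_cofactor x N k M (c : K) : 1 <= x -> 0 < N -> (0 < k)%N ->
  (forall m, m%:R * (x / N) < k%:R -> (m <= M)%N) ->
  \sum_(1 <= q < (Num.truncn x).+1 | (q %| k)%N && (x / N < q%:R)) c =
  \sum_(1 <= m < M.+1 | (m %| k)%N &&
        ((m%:R * (x / N) < k%:R) && (k%:R <= m%:R * x))) c.
Proof.
move=> x1 N0 k0 kM; have x0 : 0 <= x by lra.
rewrite (sum_range_divisors _ (fun q => x / N < q%:R)) //.
rewrite (sum_range_divisors _ (fun m => (m%:R * (x / N) < k%:R) && (k%:R <= m%:R * x))) //.
rewrite big_mkcond -sum_divisors_flip //= [RHS]big_mkcond !big_seq.
apply: eq_bigr => m; rewrite -dvdn_divisors // => mk.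
have m0 := dvdn_gt0 k0 mk; have mK : 0 < m%:R :> K by rewrite ltr0n.
have kE : k%:R = m%:R * (k %/ m)%N%:R :> K by rewrite -natrM mulnC divnK.
rewrite !ltnS truncn_ge_nat // kE ler_pM2l // ltr_pM2l //.
case: (boolP (x / N < _)) => H; rewrite ?andbF // andbT.
by rewrite kM // kE ltr_pM2l.
Qed.

(** The modulus [q = (n - a) / m] satisfies [x / N < q <= x] exactly when
    [a + m x / N < n <= a + m x]. In [lo] the minimum with [hi] makes the
    interval empty when [a + m x / N] exceeds [hi m]. *)
Lemma sum_switch G x N a M : 1 <= N -> 1 <= x -> - (x / N) < a%:~R -> a%:~R <= x ->
  (forall m, m%:R * (x / N) < x - a%:~R -> (m <= M)%N) ->
  let hi (m : nat) : K := Num.min x (a%:~R + m%:R * x) in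
  let lo (m : nat) : K := Num.min (a%:~R + m%:R * (x / N)) (hi m) in
  (forall m, (0 < m)%N -> [/\ 0 <= lo m, lo m <= hi m & hi m <= x]) /\
  \sum_(1 <= q < (Num.truncn x).+1 | x / N < q%:R) ap_sum G x q a =
  \sum_(1 <= m < M.+1)
    (\sum_(1 <= n < (Num.truncn (hi m)).+1 | n == residue a m %[mod m]) G n -
     \sum_(1 <= n < (Num.truncn (lo m)).+1 | n == residue a m %[mod m]) G n).
Proof.
move=> N1 x1 aN ax HM hi lo.
have N0 : 0 < N by lra.
have x0 : 0 <= x by lra.
have xN0 : 0 < x / N by rewrite divr_gt0 //; lra.
have xNx : x / N <= x by rewrite ler_pdivrMr // ler_peMr.
have bd m : (0 < m)%N -> [/\ 0 <= lo m, lo m <= hi m & hi m <= x].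
  move=> m0; have m1 : 1 <= m%:R :> K by rewrite ler1n.
  have h1 : x / N <= m%:R * (x / N) by rewrite ler_peMl // ltW.
  have h2 : x <= m%:R * x by rewrite ler_peMl.
  split; last 2 first.
  - by rewrite /lo ge_min lexx orbT.
  - by rewrite /hi ge_min lexx.
  by rewrite /lo /hi !le_min x0 /=; apply/andP; split; lra.
split=> //.
(* The moduli [q] are summed first, for each [n]. *)
transitivity (\sum_(1 <= n < (Num.truncn x).+1 | a < n%:Z)
  \sum_(1 <= q < (Num.truncn x).+1 | (q %| `|n%:Z - a|)%N && (x / N < q%:R)) G n).
  rewrite /ap_sum (exchange_big_dep (fun n : nat => a < n%:Z)) /=; last first.
    by move=> q n _ /andP[].
  apply: eq_bigr => n an; apply: eq_bigl => q.
  by rewrite an /= andbC eqz_mod_dvd dvdzE.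
transitivity (\sum_(1 <= m < M.+1) \sum_(1 <= n < (Num.truncn x).+1 |
    (n == residue a m %[mod m]) &&
    (Num.truncn (lo m) < n <= Num.truncn (hi m))%N) G n); last first.
  rewrite big_nat [RHS]big_nat; apply: eq_bigr => m /andP[m0 _].
  have [lo0 lohi hix] := bd m m0.
  by apply: (sum_interval _ (fun n => n == residue a m %[mod m])); apply: le_truncn.
pose D (m n : nat) := (m %| `|n%:Z - a|)%N &&
   ((m%:R * (x / N) < `|n%:Z - a|%N%:R) && (`|n%:Z - a|%N%:R <= m%:R * x)).
transitivity (\sum_(1 <= m < M.+1) \sum_(1 <= n < (Num.truncn x).+1 | (a < n%:Z) && D m n) G n);
    last first.
  rewrite big_nat [RHS]big_nat; apply: eq_bigr => m /andP[m0 _].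
  have [lo0 lohi hix] := bd m m0.
  have mx0 : 0 <= m%:R * (x / N) by rewrite mulr_ge0 // ltW.
  rewrite big_nat_cond [RHS]big_nat_cond; apply: eq_bigl => n.
  case nX : (1 <= n < (Num.truncn x).+1)%N => //=.
  have nx : n%:R <= x by rewrite -truncn_ge_nat //; case/andP: nX.
  rewrite -eqn_mod_residue // eqz_mod_dvd dvdzE /D.
  rewrite truncn_lt_nat // truncn_ge_nat ?(le_trans lo0) //.
  rewrite -(ltr_int K) -[n%:Z%:~R]/(n%:R : K).
  have [an|an] /= := ltP (a%:~R : K) n%:R; last first.
    symmetry; apply/negbTE/negP => /and3P[_ ln nh]; move: ln.
    by rewrite /lo gt_min (ltNge (hi m)) nh orbF; lra.
  have -> : `|n%:Z - a|%N%:R = n%:R - a%:~R :> K.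
    rewrite natr_absz ger0_norm ?rmorphB //= subr_ge0.
    by rewrite -(ler_int K) ltW.
  congr (_ && _); rewrite ltrBrDl lerBlDl gt_min.
  have -> : (n%:R <= hi m) = (n%:R <= a%:~R + m%:R * x) by rewrite /hi le_min nx.
  case: (leP n%:R (a%:~R + m%:R * x)) => H; rewrite ?andbT ?andbF //.
  by rewrite (ltNge (hi m)) /hi le_min nx H orbF.
rewrite [RHS](exchange_big_dep (fun n : nat => a < n%:Z)) /=; last first.
  by move=> m n _ /andP[].
rewrite big_nat_cond [RHS]big_nat_cond; apply: eq_bigr => n /andP[nX an].
under [RHS]eq_bigl => m do rewrite an /=.
apply: sum_cofactor => //; first by rewrite absz_gt0 subr_eq0 gt_eqF.
have -> : `|n%:Z - a|%N%:R = n%:R - a%:~R :> K.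
  by rewrite natr_absz ger0_norm ?rmorphB //= subr_ge0 ltW.
move=> m Hm; apply: HM; apply: (lt_le_trans Hm).
by rewrite lerD2r -truncn_ge_nat //; case/andP: nX.
Qed.

Lemma ap_sum_interval G x q a : 0 <= x -> a%:~R <= x -> (0 < q)%N ->
  ap_sum G x q a =
  \sum_(1 <= n < (Num.truncn x).+1 | n == residue a q %[mod q]) G n -
  \sum_(1 <= n < (Num.truncn (Num.max 0 (a%:~R : K))).+1
      | n == residue a q %[mod q]) G n.
Proof.
move=> x0 ax q0; have y0 : 0 <= Num.max 0 (a%:~R : K) by rewrite le_max lexx.
have yx : Num.max 0 (a%:~R : K) <= x by rewrite ge_max x0 ax.
rewrite -(sum_interval _ (fun n => n == residue a q %[mod q]) (le_truncn yx) (leqnn _)).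
rewrite /ap_sum big_nat_cond [RHS]big_nat_cond; apply: eq_bigl => n.
case nX : (1 <= n < (Num.truncn x).+1)%N => //=; case/andP: nX => n0 nX.
have nT : (n <= Num.truncn x)%N := nX.
rewrite nT andbT eqn_mod_residue // truncn_lt_nat // gt_max ltr0n n0 /=.
by rewrite -(ltr_int K) andbC.
Qed.

End Switching.

Lemma ler_norm_sumB (K : realType) (M : nat) (F1 F2 : nat -> K) (B : K) :
  \sum_(1 <= m < M.+1) `|F1 m| <= B -> \sum_(1 <= m < M.+1) `|F2 m| <= B ->
  `|\sum_(1 <= m < M.+1) (F1 m - F2 m)| <= 2 * B.
Proof.
move=> H1 H2; rewrite sumrB; apply: (le_trans (ler_normB _ _)).
rewrite mulr_natl mulr2n; apply: lerD.
  exact: le_trans (ler_norm_sum _ _ _) H1.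
exact: le_trans (ler_norm_sum _ _ _) H2.
Qed.

Theorem theorem1p6 (K : realType) (f : nat -> K) (J : nat)
    (h : nat -> nat -> K) (u : nat -> K -> K) (Q L : K -> K) :
  arithmetical_sequence f J h u Q L ->
  equidistribution f u Q L ->
  regular_scale u Q L ->
  exists C : K, forall (x N R : K) (a : int),
    1 <= x -> 0 < N -> 0 < R -> a != 0 ->
    - (x / N) < a%:~R -> a%:~R <= x ->
    L x != 0 ->
    (N + 1 <= Num.min (Q x) R) \/
    [/\ 0 < a, N <= Num.min (Q x) R & 2 <= Num.min (Q x) R] ->
    `| \sum_(1 <= q < (Num.truncn x).+1 | x / N < q%:R)
         (ap_sum f x q a - rho_star J h u R x q a) |
      <= C * (N * ln R * u1_star J h u x R
              + (ntau `|a|%N)%:R * `|Uint u 0 x / L x|)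
    /\
    `| \sum_(1 <= q < (Num.truncn N).+1)
         (ap_sum f x q a - rho_star J h u R x q a) |
      <= C * (N * ln R * u1_star J h u x R
              + (ntau `|a|%N)%:R * `|Uint u 0 x / L x|).
Proof.
move=> AS EQ reg; have [C C0 HC] := sum_moduli_error AS EQ reg.
exists (2 * C) => x N R a x1 N0 R0 a0 aN ax Lx cond.
have x0 : 0 <= x by lra.
have a0' : (0 < `|a|)%N by rewrite absz_gt0.
have subE q : ap_sum f x q a - rho_star J h u R x q a =
    ap_sum (fun n => f n - FR J h u R n) x q a by rewrite /rho_star /ap_sum sumrB.
under eq_bigr => q _ do rewrite subE.
under [X in _ /\ `|X| <= _]eq_bigr => q _ do rewrite subE.
have u10 := u1_star_ge0 J h u x R.
have R1 : 1 <= R.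
  by case: cond => [|[_ _]]; rewrite le_min => /andP[_]; lra.
have lR : 0 <= ln R by apply: ln_ge0.
set B := N * ln R * _ + _.
have B0 : 0 <= B by rewrite addr_ge0 // !mulr_ge0 // ltW.
(* For [N < 1] both sums over [q] are empty. *)
have [N1|N1] := ltP N 1.
  have tN : Num.truncn N = 0%N.
    by apply/eqP; rewrite truncn_eq ?N1 ?ltW.
  rewrite tN; split; last by rewrite big_geq // normr0 !mulr_ge0.
  rewrite big1_seq; first by rewrite normr0 !mulr_ge0.
  move=> q /andP[xq]; rewrite mem_index_iota ltnS => /andP[_ qx].
  have {}qx : q%:R <= x by rewrite -truncn_ge_nat.
  have : x <= x / N by rewrite ler_pdivlMr // ler_piMr // ltW.
  by lra.
have [Q2 R2] : 2 <= Q x /\ 2 <= R.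
  case: cond => [|[_ _]]; rewrite le_min => /andP[qN rN]; split; lra.
(* [M] is the integer part of [N + 1], or of [N] in the second case. *)
have [M [MQ MR MN HM]] : exists M, [/\ (M <= Num.truncn (Q x))%N,
    (M <= Num.truncn R)%N, M%:R <= 2 * N &
    forall m : nat, m%:R * (x / N) < x - a%:~R -> (m <= M)%N].
  have xN0 : 0 < x / N by rewrite divr_gt0 //; lra.
  have xE : x = N * (x / N) by rewrite mulrC divfK // gt_eqF.
  case: cond => [|[ap + _]]; rewrite le_min => /andP[qN rN].
    exists (Num.truncn (N + 1)); split; try exact: le_truncn.
      by apply: (@le_trans _ _ (N + 1)); rewrite ?truncn_le; lra.
    move=> m Hm; rewrite truncn_ge_nat; last by lra.
    by rewrite -(ler_pM2r xN0) mulrDl mul1r -xE; lra.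
  have aK : 0 < a%:~R :> K by rewrite ltr0z.
  exists (Num.truncn N); split; try exact: le_truncn.
    by apply: (@le_trans _ _ N); rewrite ?truncn_le; lra.
  move=> m Hm; rewrite truncn_ge_nat; last by lra.
  by rewrite -(ler_pM2r xN0) -xE; lra.
have NQR : N <= Q x /\ N <= R.
  by case: cond => [|[_ + _]]; rewrite le_min => /andP[qN rN]; split; lra.
pose G n := f n - FR J h u R n.
have HS M' (y : nat -> K) : (M' <= Num.truncn (Q x))%N -> (M' <= Num.truncn R)%N ->
    M'%:R <= 2 * N -> (forall m, (0 < m)%N -> 0 <= y m /\ y m <= x) ->
    \sum_(1 <= m < M'.+1)
      `|\sum_(1 <= n < (Num.truncn (y m)).+1 | n == residue a m %[mod m]) G n| <= C * B.
  move=> MQ' MR' MN' yP; apply: HC => // m /andP[m0 _].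
  have [y0 yx] := yP m m0.
  by split=> //; [exact: residue_bounds|exact: gcdn_residue].
split.
  have [bd ->] := sum_switch G N1 x1 aN ax HM.
  rewrite -mulrA; apply: ler_norm_sumB; apply: HS => // m /bd[lo0 lohi hix].
    by split=> //; exact: le_trans lohi.
  by split=> //; exact: le_trans hix.
rewrite big_nat; under eq_bigr => q /andP[q0 _] do rewrite ap_sum_interval //.
rewrite -big_nat -mulrA; apply: ler_norm_sumB; apply: HS.
all: try by case: NQR => ? ?; exact: le_truncn.
all: try by apply: (@le_trans _ _ N); rewrite ?truncn_le; lra.
  by move=> m _.
by move=> m _; rewrite le_max lexx ge_max x0 ax.
Qed.
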